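(* Let $\mathfrak{A}$ be a $(k,p,q)$-differential subalgebra of some $C^*$-algebra, let $\mathfrak{E}$ be a unital Banach algebra and let $\varphi:\widetilde{\mathfrak{A}}\to\mathfrak{E}$ be a continuous unital homomorphism. Set $I=\ker\varphi$. Then: (i) if $a\in\widetilde{\mathfrak{A}}$ is normal, ${\rm Spec}_{\widetilde{\mathfrak{A}}/I}(a+I)={\rm Spec}_{\mathfrak{E}}(\varphi(a))$; (ii) for a general $a\in\widetilde{\mathfrak{A}}$, ${\rm Spec}_{\widetilde{\mathfrak{A}}/I}(a+I)={\rm Spec}_{\mathfrak{E}}(\varphi(a))\cup\overline{{\rm Spec}_{\mathfrak{E}}(\varphi(a^* ))}$, where the bar denotes complex conjugation of the set.
   Context: A $(k,p,q)$-differential subalgebra of a $C^*$-algebra $\mathfrak{B}$ (with norm $\|\cdot\|_{\mathfrak{B}}$) is a $*$-subalgebra $\mathfrak{A}\subseteq\mathfrak{B}$ equipped with its own norm $\|\cdot\|_{\mathfrak{A}}$ making it a Banach $*$-algebra on which the involution is continuous, where $k\in\mathbb{Z}$, $k\geq 2$, and $p,q>0$ are reals with $p+q=k$, such that for some constant $C>0$, $\|a^k\|_{\mathfrak{A}}\leq C\|a\|_{\mathfrak{A}}^p\|a\|_{\mathfrak{B}}^q$ for all $a\in\mathfrak{A}$. $\widetilde{\mathfrak{A}}$ denotes the minimal unitization of $\mathfrak{A}$ ($\widetilde{\mathfrak{A}}=\mathfrak{A}$ if $\mathfrak{A}$ is unital). Spectra are taken in the indicated unital Banach algebras. *)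

(* Defs.v *)
From HB Require Import structures.
From mathcomp Require Import all_boot all_order all_algebra.
From mathcomp Require Import all_classical all_reals all_analysis.
From mathcomp Require Import complex.
Set Implicit Arguments. Unset Strict Implicit. Unset Printing Implicit Defensive.
Import Order.TTheory GRing.Theory Num.Theory.
Local Open Scope classical_set_scope.
Local Open Scope ring_scope.

Definition modc (R : rcfType) (l : complex R) : R := ComplexField.Normc.normc l.

Section Defs.
Variable R : realType.
Local Notation C := (complex R).

Definition normed_space (V : lmodType C) (nrm : V -> R) : Prop :=
  [/\ forall x, 0 <= nrm x,
      forall x, nrm x = 0 -> x = 0,
      forall x y, nrm (x + y) <= nrm x + nrm y &
      forall (l : C) x, nrm (l *: x) = modc l * nrm x].

Definition complete_norm (V : lmodType C) (nrm : V -> R) : Prop :=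
  forall u : nat -> V,
    (forall e : R, 0 < e -> exists N : nat, forall m n : nat,
         (N <= m)%N -> (N <= n)%N -> nrm (u m - u n) < e) ->
    exists l : V, forall e : R, 0 < e -> exists N : nat, forall n : nat,
         (N <= n)%N -> nrm (u n - l) < e.

Definition norm_continuous (V W : lmodType C) (nV : V -> R) (nW : W -> R)
  (f : V -> W) : Prop :=
  forall x (e : R), 0 < e -> exists2 d : R, 0 < d &
    forall y, nV (y - x) < d -> nW (f y - f x) < e.

Definition alg_product (V : lmodType C) (mul : V -> V -> V) : Prop :=
  [/\ forall x y z, mul x (mul y z) = mul (mul x y) z,
      forall (l : C) x y z, mul (l *: x + y) z = l *: mul x z + mul y z &
      forall (l : C) x y z, mul z (l *: x + y) = l *: mul z x + mul z y].

Definition submultiplicative (V : lmodType C) (mul : V -> V -> V) (nrm : V -> R) :=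
  forall x y, nrm (mul x y) <= nrm x * nrm y.

Definition involution (V : lmodType C) (mul : V -> V -> V) (star : V -> V) : Prop :=
  [/\ forall (l : C) x y, star (l *: x + y) = conjc l *: star x + star y,
      forall x y, star (mul x y) = mul (star y) (star x) &
      forall x, star (star x) = x].

Definition banach_star_algebra (V : lmodType C) (mul : V -> V -> V)
  (star : V -> V) (nrm : V -> R) : Prop :=
  [/\ normed_space nrm /\ complete_norm nrm, alg_product mul,
      submultiplicative mul nrm, involution mul star &
      norm_continuous nrm nrm star].

Definition cstar_algebra (V : lmodType C) (mul : V -> V -> V)
  (star : V -> V) (nrm : V -> R) : Prop :=
  banach_star_algebra mul star nrm /\
  forall x, nrm (mul (star x) x) = nrm x ^+ 2.

Definition star_alg_hom (V W : lmodType C) (mulV : V -> V -> V) (starV : V -> V)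
  (mulW : W -> W -> W) (starW : W -> W) (f : V -> W) : Prop :=
  [/\ forall (l : C) x y, f (l *: x + y) = l *: f x + f y,
      forall x y, f (mulV x y) = mulW (f x) (f y) &
      forall x, f (starV x) = starW (f x)].

(* x^k for k >= 1 in a possibly non-unital algebra *)
Fixpoint npow (V : Type) (mul : V -> V -> V) (x : V) (k : nat) : V :=
  match k with
  | 0 | 1 => x
  | k'.+1 => mul (npow mul x k') x
  end.

(* (k,p,q)-differential subalgebra: A sits inside the C*-algebra B through
   the injective *-homomorphism iota (the inclusion). *)
Definition differential_subalgebra (k : nat) (p q : R)
  (A : lmodType C) (mulA : A -> A -> A) (starA : A -> A) (nrmA : A -> R)
  (B : lmodType C) (mulB : B -> B -> B) (starB : B -> B) (nrmB : B -> R)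
  (iota : A -> B) : Prop :=
  [/\ cstar_algebra mulB starB nrmB,
      banach_star_algebra mulA starA nrmA,
      injective iota /\ star_alg_hom mulA starA mulB starB iota,
      [/\ (2 <= k)%N, 0 < p, 0 < q & p + q = k%:R] &
      exists2 K : R, 0 < K & forall a : A,
        nrmA (npow mulA a k) <= K * (nrmA a `^ p) * (nrmB (iota a) `^ q)].

Definition has_unit (A : Type) (mulA : A -> A -> A) : Prop :=
  exists e : A, forall x, mulA e x = x /\ mulA x e = x.

(* U (a unital algebra, with involution starU and norm nrmU) together with the
   embedding j : A -> U is the minimal unitization of A:
   U = A if A is unital, U = A (+) C 1 with the l^1 norm otherwise. *)
Definition min_unitization
  (A : lmodType C) (mulA : A -> A -> A) (starA : A -> A) (nrmA : A -> R)
  (U : algType C) (starU : U -> U) (nrmU : U -> R) (j : A -> U) : Prop :=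
  [/\ involution *%R starU,
      injective j /\ star_alg_hom mulA starA *%R starU j,
      forall u : U, exists a (l : C), u = j a + l%:A,
      has_unit mulA -> (forall u : U, exists a, u = j a) /\
                       (forall a, nrmU (j a) = nrmA a) &
      ~ has_unit mulA -> forall a (l : C), nrmU (j a + l%:A) = nrmA a + modc l].

Definition unital_banach_algebra (E : algType C) (nrmE : E -> R) : Prop :=
  [/\ normed_space nrmE, complete_norm nrmE & submultiplicative *%R nrmE].

Definition cont_unital_hom (U E : algType C) (nrmU : U -> R) (nrmE : E -> R)
  (phi : U -> E) : Prop :=
  [/\ forall (l : C) x y, phi (l *: x + y) = l *: phi x + phi y,
      forall x y, phi (x * y) = phi x * phi y,
      phi 1 = 1 & norm_continuous nrmU nrmE phi].

Definition invertible (X : algType C) (x : X) : Prop :=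
  exists y : X, x * y = 1 /\ y * x = 1.

Definition spec (X : algType C) (x : X) : set C :=
  [set l | ~ invertible (x - l%:A)].

(* invertibility of x + I in the quotient algebra X / I, I a two-sided ideal *)
Definition invertible_mod (X : algType C) (I : set X) (x : X) : Prop :=
  exists y : X, I (x * y - 1) /\ I (y * x - 1).

Definition spec_quot (X : algType C) (I : set X) (x : X) : set C :=
  [set l | ~ invertible_mod I (x - l%:A)].

Definition ker_of (X Y : algType C) (f : X -> Y) : set X := [set x | f x = 0].

Definition conj_set (S : set C) : set C := [set conjc l | l in S].

End Defs.

(* Main.v *)
Require Import Defs.
From HB Require Import structures.
From mathcomp Require Import all_boot all_order all_algebra.
From mathcomp Require Import all_classical all_reals all_analysis.
From mathcomp Require Import complex.
From mathcomp Require Import ring lra.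
Set Implicit Arguments.
Unset Strict Implicit.
Unset Printing Implicit Defensive.
Import Order.TTheory GRing.Theory Num.Theory.
Import numFieldNormedType.Exports.
Local Open Scope classical_set_scope.
Local Open Scope ring_scope.

(** The C*-identity bounds a unitary u of the unitization U in the norm of the
    C*-algebra, so the differential inequality gives |u^k| <= C |u|^r with r < k.
    Iterating, |u^n| = O(exp (c n^g)) for some g < 1. This has two consequences.

    First, u has its spectrum on the unit circle, hence (by Cayley transforms)
    self-adjoint elements of U have real spectrum. If phi x = 0, then
    1 + phi x^* = phi (1 + x^* - x) is therefore invertible; so if x is invertible
    modulo I, both phi x and phi x^* are invertible.

    Second, there are bump functions F = sum_n d_n u^n in U supported near 1: take
    for d_n the infinite product of the cos (n b), where the b are so many that
    sum_n d_n |n| |u^n| converges but have a small sum. If phi (1 - u) is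
    invertible, then phi F = 0, because F is a mean of Abel kernels of rotations of
    u. Since F - F(1) is a multiple of 1 - u, the element 1 - u is invertible
    modulo I. Through the Cayley transform the same holds for self-adjoint h:
    if phi h is invertible, h is invertible modulo I. If phi x and phi x^* are
    invertible, this applies to x^* x and x x^*, which proves (ii).

    For (i) it remains to see that if a is normal and phi a is invertible, so is
    phi a^*; this follows from an estimate of the spectral radius of
    a (a^* a + it)^-1 in U for small t. *)

(* [zmod] decides equalities between sums in an abelian group, by cancelling the
   last summand against its opposite until nothing is left; [ncring] first
   expands products, which need not commute. *)
Ltac zmod_cancel_opp u :=
  first [rewrite (addrK u) | rewrite (subrr u)
        | rewrite (addrAC _ _ (- u)); zmod_cancel_opp u].
Ltac zmod_cancel u :=
  first [rewrite (subrK u) | rewrite (addNr u)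
        | rewrite (addrAC _ _ u); zmod_cancel u].
Ltac zmod_normalize := rewrite ?(opprD, opprK, addrA, oppr0, addr0, add0r).
Ltac zmod_loop :=
  lazymatch goal with
  | |- 0 = 0 => reflexivity
  | |- _ - ?u = 0 => zmod_cancel_opp u; rewrite ?add0r; zmod_loop
  | |- _ + ?u = 0 => zmod_cancel u; rewrite ?add0r; zmod_loop
  end.
Ltac zmod :=
  apply/eqP; rewrite -subr_eq0; apply/eqP; zmod_normalize; zmod_loop.
Ltac ncring :=
  rewrite ?(mulrDl, mulrDr, mulNr, mulrN, opprK, mulr1, mul1r, mulr0, mul0r, mulrA); zmod.

(** * Real estimates: subexponential growth and the coefficients of the bump functions *)

Section RealLemmas.
Variable R : realType.
Implicit Types (k m n : nat) (r s x y : R) (e : nat -> R).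

Lemma bernoulli_le x n : 0 <= x -> 1 + n%:R * x <= (1 + x) ^+ n.
Proof.
move=> x0; elim: n => [|n IH]; first by rewrite expr0 mul0r addr0.
rewrite exprS -natr1.
have h : (1 + x) * (1 + n%:R * x) <= (1 + x) * (1 + x) ^+ n.
  by rewrite ler_wpM2l// addr_ge0.
have := mulr_ge0 (ler0n R n) (sqr_ge0 x); nra.
Qed.

Lemma expr_ge_eventually q K : 1 < q ->
  exists m0 : nat, forall m, (m0 <= m)%N -> K <= q ^+ m :> R.
Proof.
move=> q1; exists (Num.truncn (K / (q - 1))).+1 => m hm.
have q0 : 0 < q - 1 by lra.
have h1 : K / (q - 1) < m%:R.
  by apply: lt_le_trans (truncnS_gt _) _; rewrite ler_nat.
rewrite ltr_pdivrMr// in h1.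
have := bernoulli_le m (ltW q0); rewrite subrKC => h2; lra.
Qed.

Lemma natr_le_expr r : 1 < r -> exists2 C : R, 0 <= C & forall m, m%:R <= C * r ^+ m.
Proof.
move=> r1; have r0 : 0 < r - 1 by lra.
exists (r - 1)^-1; first by rewrite invr_ge0 ltW.
move=> m; rewrite mulrC ler_pdivlMr//.
have := bernoulli_le m (ltW r0); rewrite subrKC => h2; lra.
Qed.

(* That is, e n = O(exp (c' n^g)) with g = log_k r. *)
Definition subexp k r e : Prop :=
  exists2 c : R, 0 <= c & forall m n, (n < k ^ m)%N -> e n <= expR (c * r ^+ m).

Lemma subexp_max k r e e' : 0 <= r -> subexp k r e -> subexp k r e' ->
  subexp k r (fun n => Num.max (e n) (e' n)).
Proof.
move=> r0 [c c0 he] [c' c'0 he']; exists (c + c') => [|m n mn]; first by rewrite addr_ge0.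
rewrite ge_max; apply/andP; split.
- apply: le_trans (he _ _ mn) _; rewrite ler_expR ler_wpM2r ?exprn_ge0//; lra.
- apply: le_trans (he' _ _ mn) _; rewrite ler_expR ler_wpM2r ?exprn_ge0//; lra.
Qed.

(** For n between k^m and k^(m+1), ln (e n) is at most c r^(m+1), while s^n contributes at most -k^m
    |ln s|; since r < k, the second term wins for large m. *)
Lemma subexp_geometric k r e s : (1 < k)%N -> 1 < r < k%:R -> subexp k r e ->
  (forall n, 0 <= e n) ->
  0 < s < 1 -> exists K, forall n, s ^+ n * e n <= K.
Proof.
move=> k1 /andP[r1 rk] [c c0 he] e0 /andP[s0 s1].
have sig0 : 0 < - ln s by rewrite oppr_gt0; apply: ln_lt0; rewrite s0.
have r0 : 0 < r by lra.
have k0 : 0 < k%:R :> R by lra.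
have q1 : 1 < k%:R / r by rewrite ltr_pdivlMr// mul1r.
have [m0 hm0] := expr_ge_eventually (c * k%:R / - ln s) q1.
exists (expR (c * r ^+ m0)) => n.
have sE : s = expR (ln s) by rewrite lnK.
have [nm|mn] := ltnP n (k ^ m0)%N.
  by apply: le_trans (he _ _ nm); rewrite ler_piMl// exprn_ile1// ltW.
apply: (@le_trans _ _ 1); last by rewrite -expR0 ler_expR mulr_ge0// exprn_ge0// ltW.
have n0 : (0 < n)%N by apply: leq_trans mn; rewrite expn_gt0 (ltnW k1).
pose m := trunc_log k n.
have mm : (m0 <= m)%N by apply: trunc_log_max.
have /andP[mn1 nm1] : (k ^ m <= n < k ^ m.+1)%N by exact: trunc_log_bounds.
apply: le_trans (ler_wpM2l (exprn_ge0 _ (ltW s0)) (he _ _ nm1)) _.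
rewrite {1}sE -expRM_natl -expRD -{2}expR0 ler_expR.
have := hm0 _ mm; rewrite expr_div_n ler_pdivlMr ?exprn_gt0//.
rewrite mulrAC ler_pdivrMr// => h.
have h2 : k%:R ^+ m <= n%:R :> R by rewrite -natrX ler_nat.
have h3 : c * r ^+ m.+1 <= c * k%:R * r ^+ m.
  rewrite exprS mulrA ler_wpM2r ?exprn_ge0 ?(ltW r0)//.
  by rewrite ler_wpM2l// ltW.
have h4 : k%:R ^+ m * - ln s <= n%:R * - ln s by rewrite ler_wpM2r// ltW.
lra.
Qed.

Lemma norm_sin_le x : 0 <= x -> `|sin x| <= x.
Proof.
rewrite le_eqVlt => /orP[/eqP <-|x0]; first by rewrite sin0 normr0.
have cs : {within `[0, x], continuous (@sin R)}.
  by apply: continuous_subspaceT => t; exact: continuous_sin.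
have [c _] := MVT x0 (fun t _ => is_derive_sin t) cs.
rewrite sin0 !subr0 => ->; rewrite normrM (gtr0_norm x0) ler_piMl ?cos_max//.
exact: ltW.
Qed.

Lemma one_sub_cos_le x : 0 <= x -> 2 - cos x *+ 2 <= x ^+ 2.
Proof.
move=> x0.
have xE : x = (x / 2) *+ 2 by rewrite -mulr_natr divfK// pnatr_eq0.
have h0 : 0 <= x / 2 by rewrite divr_ge0.
have h1 : sin (x / 2) ^+ 2 <= (x / 2) ^+ 2.
  by have := norm_sin_le h0; rewrite ler_norml => /andP[? ?]; nra.
rewrite xE cos_mulr2n -xE; have := sin2cos2 (x / 2); lra.
Qed.

Lemma prod_cos_nseq (T : Type) (s : seq T) (N : T -> nat) (b : T -> R) (y : R) :
  \prod_(x <- flatten [seq nseq (N t) (b t) | t <- s]) cos (y * x) =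
  \prod_(t <- s) cos (y * b t) ^+ N t.
Proof.
rewrite big_flatten big_map; apply: eq_bigr => t _.
by rewrite big_nseq iter_mulr_1.
Qed.

Lemma sum_nseq (T : Type) (s : seq T) (N : T -> nat) (b : T -> R) :
  \sum_(x <- flatten [seq nseq (N t) (b t) | t <- s]) x =
  \sum_(t <- s) b t *+ N t.
Proof.
rewrite big_flatten big_map; apply: eq_bigr => t _.
by rewrite big_nseq iter_addr_0.
Qed.

Lemma sum_geometric_le (q : R) n : 0 <= q < 1 ->
  \sum_(i < n) q ^+ i <= (1 - q)^-1.
Proof.
move=> /andP[q0 q1]; have h : 0 < 1 - q by lra.
rewrite -[leRHS]mul1r ler_pdivlMr// mulrC.
have := subrX1 q n; have := exprn_ge0 n q0; lra.
Qed.

(** [d n] is the product over m >= m0 of cos (n k^-m)^(2 N_m), with N_m about kap r^m. As r < k, the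
    frequencies have a finite sum, small for large [m0]. For n between k^(m-1) and k^m, the factor
    of index m alone beats [e n]. One of the three powers of n + 1 pays for dividing by 1 - u later,
    the other two make the series converge. *)
Lemma bump_coefs k r e (eps : R) : (1 < k)%N -> 1 < r < k%:R -> subexp k r e ->
  (forall n, 0 <= e n) -> 0 < eps ->
  exists (d : nat -> R) (bs : nat -> seq R),
  [/\ d 0%N = 1, forall n, 0 <= d n,
      forall L (del : R), 0 < del -> exists M, forall n, (n < L)%N ->
        `|d n - \prod_(b <- bs M) cos (n%:R * b)| <= del,
      forall M, {in bs M, forall b, 0 <= b} /\ \sum_(b <- bs M) b <= eps &
      exists K, forall n, d n * e n * n.+1%:R ^+ 3 <= K].
Proof.
move=> k1 /andP[r1 rk] [c c0 he] e0 eps0.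
have r0 : 0 < r by lra.
have k0 : 0 < k%:R :> R by lra.
pose rho := cos (k%:R^-1 : R).
have ki1 : 0 < (k%:R^-1 : R) < 1.
  by rewrite invr_gt0 k0 invf_lt1// (_ : 1 = 1%:R)// ltr_nat.
have pi2 : 2 <= pi :> R by exact: pi_ge2.
have rho01 : 0 < rho < 1.
  apply/andP; split.
    by apply: cos_gt0_pihalf; apply/andP; split; lra.
  by rewrite -cos0 ltr_cos ?in_itv/=; lra.
have lam0 : 0 < - ln rho by rewrite oppr_gt0; exact: ln_lt0.
have [C1 C10 hC1] := natr_le_expr r1.
have lnk0 : 0 <= ln (k%:R : R) by apply: ln_ge0; rewrite (ler_nat R 1) ltnW.
(* With this constant, rho^(kap r^m) absorbs both expR (c r^m) and (k^m)^3, because m <= C1 r^m. *)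
pose kap := (C1 * (3 * ln (k%:R : R)) + c) / - ln rho.
have kap0 : 0 <= kap by rewrite divr_ge0 ?(ltW lam0)// addr_ge0// !mulr_ge0.
pose N m := (Num.truncn (kap * r ^+ m)).+1.
have N_ge m : kap * r ^+ m <= (N m)%:R by exact/ltW/truncnS_gt.
have rm1 m : 1 <= r ^+ m by rewrite exprn_ege1// ltW.
have N_le m : (N m)%:R <= (kap + 1) * r ^+ m.
  rewrite /N -natr1 mulrDl mul1r lerD// truncn_le mulr_ge0//.
  by rewrite (le_trans ler01).
have q01 : 0 < r / k%:R < 1 by rewrite divr_gt0// ltr_pdivrMr// mul1r.
(* The left side bounds the tail, from index [m0] on, of the series of the 2 N_m k^-m. *)
have [m0 hm0] : exists m0 : nat,
    2 * (kap + 1) / (1 - r / k%:R) * (r / k%:R) ^+ m0 <= eps.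
  have q1 : 1 < k%:R / r by rewrite ltr_pdivlMr// mul1r.
  have [m0 hm0] := expr_ge_eventually (2 * (kap + 1) / (1 - r / k%:R) / eps) q1.
  exists m0; have := hm0 _ (leqnn _); rewrite ler_pdivrMr// => h.
  have qE : (r / k%:R) ^+ m0 = ((k%:R / r) ^+ m0)^-1 by rewrite -exprVn invf_div.
  by rewrite qE ler_pdivrMr ?exprn_gt0 ?divr_gt0// [leRHS]mulrC.
(* The even exponents put every factor in [0, 1], so that the partial products decrease in [M]. *)
pose P (M n : nat) : R := \prod_(0 <= i < M) cos (n%:R * k%:R ^- (m0 + i)) ^+ (N (m0 + i)%N).*2.
have fac01 (y : R) j : 0 <= cos y ^+ j.*2 <= 1.
  have /andP[s0 s1] : 0 <= cos y ^+ 2 <= 1 by rewrite sqr_ge0 cos2sin2 gerBl sqr_ge0.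
  by rewrite -mul2n exprM exprn_ge0//= exprn_ile1.
have P01 M n : 0 <= P M n <= 1.
  apply/andP; split; last by apply: prodr_ile1 => i _; exact: fac01.
  by apply: prodr_ge0 => i _; case/andP: (fac01 (n%:R * k%:R ^- (m0 + i)) (N (m0 + i)%N)).
have PS M n : P M.+1 n <= P M n.
  rewrite /P big_nat_recr//= -/(P M n); apply: ler_piMr.
    by case/andP: (P01 M n).
  by case/andP: (fac01 (n%:R * k%:R ^- (m0 + M)) (N (m0 + M)%N)).
have Pni n : nonincreasing_seq (P ^~ n) by apply/nonincreasing_seqP => M.
have Pcvg n : cvgn (P ^~ n).
  apply: nonincreasing_is_cvgn => //; exists 0 => _ [M _ <-].
  by case/andP: (P01 M n).
pose d n := limn (P ^~ n).
have d_le n M : d n <= P M n by exact: nonincreasing_cvgn_ge.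
have d_ge0 n : 0 <= d n.
  by apply: limr_ge => //; apply: nearW => M; case/andP: (P01 M n).
exists d, (fun M => flatten [seq nseq (N (m0 + i)%N).*2 (k%:R ^- (m0 + i)) | i <- iota 0 M]).
have PE M n : P M n = \prod_(b <- flatten [seq nseq (N (m0 + i)%N).*2 (k%:R ^- (m0 + i))
     | i <- iota 0 M]) cos (n%:R * b).
  by rewrite (prod_cos_nseq _ (fun i => (N (m0 + i)%N).*2)) /P /index_iota subn0.
split => //.
- have P0 M : P M 0%N = 1.
    by rewrite /P big1// => i _; rewrite mul0r cos0 expr1n.
  rewrite /d (_ : P ^~ 0%N = fun=> 1) ?lim_cst//; exact/funext.
- move=> L del del0.
  have H n : exists M0, forall M, (M0 <= M)%N -> `|d n - P M n| <= del.
    have /cvgrPdist_le/(_ _ del0) [M0 _ h] := Pcvg n.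
    by exists M0 => M hM; exact: h.
  have [M hM] : exists M0, forall M, (M0 <= M)%N -> forall n, (n < L)%N ->
      `|d n - P M n| <= del.
    elim: L => [|L [M0 IH]]; first by exists 0%N.
    have [M1 h1] := H L; exists (maxn M0 M1) => M.
    rewrite geq_max => /andP[hM0 hM1] n; rewrite ltnS leq_eqVlt => /orP[/eqP ->|].
      exact: h1.
    exact: IH.
  by exists M => n nL; rewrite -PE; exact: hM.
- move=> M; split.
    move=> b /flattenP[l /mapP[i _ ->]]; rewrite mem_nseq => /andP[_ /eqP ->].
    by rewrite invr_ge0 exprn_ge0// ltW.
  rewrite (sum_nseq _ (fun i => (N (m0 + i)%N).*2)).
  apply: le_trans hm0.
  rewrite -{1}[M]subn0 -/(index_iota 0 M) big_mkord.
  apply: (@le_trans _ _ (\sum_(i < M) 2 * (kap + 1) * (r / k%:R) ^+ m0 * (r / k%:R) ^+ i)).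
    apply: ler_sum => i _.
    rewrite -[leLHS]mulr_natr -mul2n natrM -[leRHS]mulrA -exprD expr_div_n mulrC !mulrA.
    rewrite ler_wpM2r ?invr_ge0 ?exprn_ge0 ?(ltW k0)// -!mulrA ler_wpM2l//.
  rewrite -mulr_sumr mulrAC -!mulrA ler_wpM2l//.
  rewrite ler_wpM2l ?addr_ge0// ler_wpM2r//; first by rewrite exprn_ge0//; lra.
  by rewrite sum_geometric_le//; case/andP: q01 => /ltW -> ->.
- exists (Num.max 1 (expR (c * r ^+ m0) * (k%:R ^+ m0) ^+ 3)) => n.
  rewrite le_max; have [nm|mn] := ltnP n (k ^ m0)%N.
    apply/orP; right; rewrite ler_pM ?mulr_ge0//.
      rewrite -[leRHS]mul1r ler_pM// ?he//.
      by apply: le_trans (d_le n 0%N) _; case/andP: (P01 0%N n).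
    by rewrite lerXn2r ?nnegrE ?exprn_ge0 ?(ltW k0)// -natrX ler_nat.
  apply/orP; left.
  have n0 : (0 < n)%N by apply: leq_trans mn; rewrite expn_gt0 (ltnW k1).
  pose m' := trunc_log k n.
  have mm : (m0 <= m')%N by apply: trunc_log_max.
  have /andP[mn1 nm1] : (k ^ m' <= n < k ^ m'.+1)%N by exact: trunc_log_bounds.
  (* Now y lies between 1/k and 1, where the cosine is nonnegative and at most [rho]; this factor is
     kept and the others are bounded by 1. *)
  pose m := m'.+1; pose y : R := n%:R * k%:R ^- m.
  have km0 : 0 < k%:R ^+ m :> R by rewrite exprn_gt0.
  have y1 : k%:R^-1 <= y <= 1.
    rewrite /y ler_pdivlMr// ler_pdivrMr// mul1r -natrX ler_nat ltnW// andbT.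
    by rewrite natrX exprS mulKf ?gt_eqF// -natrX ler_nat.
  have cy : 0 <= cos y <= rho.
    apply/andP; split; first by apply: cos_ge0_pihalf; apply/andP; split; lra.
    by rewrite /rho leNgt ltr_cos ?in_itv/=; lra.
  have dn : d n <= rho ^+ (N m).*2.
    apply: le_trans (d_le n (m - m0).+1) _.
    rewrite /P big_nat_recr//= subnKC ?leqW// -/y.
    apply: le_trans (_ : cos y ^+ (N m).*2 <= _).
      rewrite ler_piMl//; first by case/andP: (fac01 y (N m)).
      by case/andP: (P01 (m - m0)%N n).
    by case/andP: cy => cy0 cyr; rewrite lerXn2r ?nnegrE// (le_trans cy0).
  have en : e n <= expR (c * r ^+ m) by exact: he.
  have nn : n.+1%:R ^+ 3 <= expR (ln (k%:R : R) * m%:R) ^+ 3.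
    rewrite lerXn2r ?nnegrE ?expR_ge0// expRM_natr lnK ?posrE//.
    by rewrite -natrX ler_nat.
  apply: le_trans (_ : rho ^+ (N m).*2 * expR (c * r ^+ m) * expR (ln (k%:R : R) * m%:R) ^+ 3 <= _).
    by apply: ler_pM nn; [exact: mulr_ge0|exact: exprn_ge0|exact: ler_pM].
  have rhoE : rho = expR (ln rho) by rewrite lnK// posrE; case/andP: rho01.
  rewrite {1}rhoE -!expRM_natl -!expRD -[leRHS]expR0 ler_expR.
  have h1 := N_ge m; have h2 := hC1 m.
  rewrite -mul2n natrM.
  have h3 : (C1 * (3 * ln (k%:R : R)) + c) * r ^+ m <= (N m)%:R * - ln rho.
    by move: h1; rewrite /kap mulrAC ler_pdivrMr.
  have h4 : m%:R * (3 * ln (k%:R : R)) <= C1 * r ^+ m * (3 * ln k%:R).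
    by rewrite ler_wpM2r// mulr_ge0.
  have h5 : 0 <= (N m)%:R * - ln rho by rewrite mulr_ge0// ltW.
  move: h3 h4 h5; set a := ln rho; set b := ln _; set z := r ^+ m.
  clearbody a b z; clear => *; lra.
Qed.

Lemma one_sub_expr_le (s : R) n : 0 <= s <= 1 -> 0 <= 1 - s ^+ n <= n%:R * (1 - s).
Proof.
move=> /andP[s0 s1]; rewrite subr_ge0 exprn_ile1//=.
elim: n => [|n IH]; first by rewrite expr0 subrr mul0r.
have sn := exprn_ge0 n s0; have sn1 : s ^+ n <= 1 by exact: exprn_ile1.
rewrite exprS -natr1; nra.
Qed.

Lemma sum_inv_sqr_le n : \sum_(i < n) i.+1%:R ^- 2 <= 2 :> R.
Proof.
case: n => [|n]; first by rewrite big_ord0.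
(* The induction needs this sharper bound, which telescopes. *)
suff h : \sum_(i < n.+1) i.+1%:R ^- 2 <= 2 - n.+1%:R^-1 :> R.
  by apply: le_trans h _; rewrite gerBl invr_ge0.
elim: n => [|n IH]; first by rewrite big_ord_recr big_ord0 /= expr1n invr1; lra.
rewrite big_ord_recr /=; apply: le_trans (lerD IH (lexx _)) _.
have n0 : 0 < n.+1%:R :> R by rewrite ltr0n.
rewrite -[n.+2%:R]natr1 -subr_ge0; move: (n.+1%:R) n0 => a a0.
have -> : 2 - (a + 1)^-1 - (2 - a^-1 + (a + 1) ^- 2) = (a * (a + 1) ^+ 2)^-1.
  by field; rewrite !gt_eqF//; lra.
by rewrite invr_ge0 mulr_ge0 ?sqr_ge0 ?ltW.
Qed.

(** The bound in [subexp] is the same for all n below k^m, so it passes to the running maximum,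
    which dominates all powers up to n at once. *)
Lemma subexp_bigmax (k : nat) (r : R) (e : nat -> R) : subexp k r e ->
  subexp k r (fun n => \big[Num.max/0]_(i < n.+1) e i).
Proof.
move=> [c c0 he]; exists c => // m n nm; apply: bigmax_le; first exact: expR_ge0.
by move=> i _; apply: he; apply: leq_ltn_trans nm; rewrite -ltnS ltn_ord.
Qed.
End RealLemmas.

(** * The modulus of complex numbers *)

Section Modulus.
Variable R : rcfType.
Implicit Types (x y : R[i]) (t : R).

Lemma modcM x y : modc (x * y) = modc x * modc y.
Proof. exact: ComplexField.Normc.normcM. Qed.

Lemma modcV x : modc x^-1 = (modc x)^-1.
Proof. exact: ComplexField.Normc.normcV. Qed.

Lemma modcN x : modc (- x) = modc x.
Proof. exact: normcN. Qed.

Lemma modcD x y : modc (x + y) <= modc x + modc y.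
Proof. exact: le_normcD. Qed.

Lemma modc_eq0 x : modc x = 0 -> x = 0.
Proof. exact: ComplexField.Normc.eq0_normc. Qed.

Lemma modc0 : modc (0 : R[i]) = 0.
Proof. exact: ComplexField.Normc.normc0. Qed.

Lemma modc1 : modc (1 : R[i]) = 1.
Proof. exact: ComplexField.Normc.normc1. Qed.

Lemma modcX x n : modc (x ^+ n) = modc x ^+ n.
Proof. by elim: n => [|n IH]; rewrite ?expr0 ?modc1// !exprS modcM IH. Qed.

Lemma modc_ge0 x : 0 <= modc x.
Proof. by case: x => a b; exact: sqrtr_ge0. Qed.

Lemma modc_real t : modc (t%:C)%C = `|t|.
Proof. by rewrite /modc /= expr0n /= addr0 sqrtr_sqr. Qed.

Lemma modcJ x : modc (conjc x) = modc x.
Proof. by case: x => a b; rewrite /modc /= sqrrN. Qed.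

Lemma modc_i : modc ('i%C : R[i]) = 1.
Proof. by rewrite /modc /= expr0n expr1n add0r sqrtr1. Qed.

Lemma modc_Re x : `|complex.Re x| <= modc x.
Proof.
case: x => a b; rewrite /modc /= -sqrtr_sqr ler_sqrt ?addr_ge0 ?sqr_ge0//.
by rewrite lerDl sqr_ge0.
Qed.

Lemma modc_Im x : `|complex.Im x| <= modc x.
Proof.
case: x => a b; rewrite /modc /= -sqrtr_sqr ler_sqrt ?addr_ge0 ?sqr_ge0//.
by rewrite lerDr sqr_ge0.
Qed.

Lemma modc_le x : modc x <= `|complex.Re x| + `|complex.Im x|.
Proof.
rewrite {1}[x]complexE (le_trans (modcD _ _))// modcM modc_i mul1r.
by rewrite !modc_real.
Qed.

Lemma modc_gt0 x : x != 0 -> 0 < modc x.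
Proof.
by move=> x0; rewrite lt0r modc_ge0 andbT; apply: contra_neq x0; exact: modc_eq0.
Qed.
End Modulus.

(** * Invertible elements of an algebra *)

Section Invertible.
Variables (R : realType) (X : algType R[i]).
Implicit Types x y z : X.

Lemma invertible1 : invertible (1 : X).
Proof. by exists 1; rewrite mulr1. Qed.

Lemma invertibleM x y : invertible x -> invertible y -> invertible (x * y).
Proof.
move=> [a [xa ax]] [b [yb by_]]; exists (b * a); split.
  by rewrite mulrA -(mulrA x) yb mulr1.
by rewrite mulrA -(mulrA b) ax mulr1.
Qed.

Lemma invertibleZ (l : R[i]) x : l != 0 -> invertible x -> invertible (l *: x).
Proof.
move=> l0 [a [xa ax]]; exists (l^-1 *: a).
by rewrite -!scalerAl -!scalerAr !scalerA divff// mulVf// xa ax !scale1r.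
Qed.

(** A right inverse y a and a left inverse b z of x coincide. *)
Lemma invertible_factors x y z :
  invertible (x * y) -> invertible (z * x) -> invertible x.
Proof.
move=> [a [xya _]] [b [_ bzx]]; exists (y * a); rewrite mulrA; split=> //.
have h : b * z = y * a.
  by rewrite -[LHS]mulr1 -xya !mulrA -(mulrA b) bzx mul1r.
by rewrite -h -mulrA.
Qed.

Lemma invertible_commM x y : GRing.comm x y -> invertible (x * y) -> invertible x.
Proof. by move=> xy xyV; apply: (invertible_factors (z := y) xyV); rewrite -xy. Qed.

Lemma comm_inverse x y z : x * y = 1 -> y * x = 1 -> GRing.comm x z -> GRing.comm y z.
Proof.
move=> xy yx xz; rewrite /GRing.comm.
by rewrite -[LHS]mulr1 -xy mulrA -(mulrA y z x) -xz mulrA yx mul1r.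
Qed.
End Invertible.

(** * Norms, limits and series in a unital Banach algebra *)

Section NormedAlgebra.
Variables (R : realType) (X : algType R[i]) (nrm : X -> R).
Hypothesis hX : unital_banach_algebra nrm.
Implicit Types (x y z : X) (c : R[i]).

Lemma nrm_ge0 x : 0 <= nrm x.
Proof. by case: hX => -[h _ _ _] _ _; exact: h. Qed.

Lemma nrm_eq0 x : nrm x = 0 -> x = 0.
Proof. by case: hX => -[_ h _ _] _ _; exact: h. Qed.

Lemma nrmD x y : nrm (x + y) <= nrm x + nrm y.
Proof. by case: hX => -[_ _ h _] _ _; exact: h. Qed.

Lemma nrmZ c x : nrm (c *: x) = modc c * nrm x.
Proof. by case: hX => -[_ _ _ h] _ _; exact: h. Qed.

Lemma nrmM x y : nrm (x * y) <= nrm x * nrm y.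
Proof. by case: hX => _ _ h; exact: h. Qed.

Lemma nrm0 : nrm 0 = 0.
Proof. by rewrite -(scale0r (0 : X)) nrmZ modc0 mul0r. Qed.

Lemma nrmN x : nrm (- x) = nrm x.
Proof. by rewrite -scaleN1r nrmZ modcN modc1 mul1r. Qed.

Lemma nrmB x y : nrm (x - y) <= nrm x + nrm y.
Proof. by rewrite -(nrmN y) nrmD. Qed.

Lemma nrmBC x y : nrm (x - y) = nrm (y - x).
Proof. by rewrite -nrmN opprB. Qed.

Lemma nrm_sum (I : Type) (s : seq I) (P : pred I) (F : I -> X) :
  nrm (\sum_(i <- s | P i) F i) <= \sum_(i <- s | P i) nrm (F i).
Proof.
elim/big_rec2: _ => [|i a b _ h]; first by rewrite nrm0.
by apply: le_trans (nrmD _ _) _; rewrite lerD2l.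
Qed.

Lemma nrmXM x y n : nrm (x ^+ n * y) <= nrm x ^+ n * nrm y.
Proof.
elim: n => [|n IH]; first by rewrite !expr0 !mul1r.
rewrite !exprS -!mulrA (le_trans (nrmM _ _))//.
by rewrite ler_wpM2l ?nrm_ge0.
Qed.

Definition nlim (u : nat -> X) (l : X) : Prop :=
  forall e : R, 0 < e -> exists N : nat, forall n, (N <= n)%N -> nrm (u n - l) < e.

Lemma nlim_unique u l l' : nlim u l -> nlim u l' -> l = l'.
Proof.
move=> ul ul'; apply/eqP; rewrite -subr_eq0; apply/eqP/nrm_eq0/eqP.
rewrite eq_le nrm_ge0 andbT; apply/ler_addgt0Pr => e e0; rewrite add0r.
have [N hN] := ul _ (divr_gt0 e0 (ltr0n R 2)).
have [M hM] := ul' _ (divr_gt0 e0 (ltr0n R 2)).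
have h1 := hN _ (leq_maxl N M); have h2 := hM _ (leq_maxr N M).
have -> : l - l' = (u (maxn N M) - l') - (u (maxn N M) - l).
  by rewrite opprB [RHS]addrC subrKA.
apply: le_trans (nrmB _ _) _; lra.
Qed.

Lemma nlimD u v l l' : nlim u l -> nlim v l' -> nlim (fun n => u n + v n) (l + l').
Proof.
move=> ul vl e e0.
have [N hN] := ul _ (divr_gt0 e0 (ltr0n R 2)).
have [M hM] := vl _ (divr_gt0 e0 (ltr0n R 2)).
exists (maxn N M) => n; rewrite geq_max => /andP[/hN h1 /hM h2].
rewrite opprD addrACA (le_lt_trans (nrmD _ _))//; lra.
Qed.

Lemma nlim_bounded (u : nat -> X) l (b : nat -> R) :
  b @ \oo --> (0 : R) -> (forall n, nrm (u n - l) <= b n) -> nlim u l.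
Proof.
move=> /cvgrPdist_lt b0 h e /b0[N _ hN]; exists N => n /hN.
rewrite sub0r normrN; apply: le_lt_trans; apply: le_trans (h n) (ler_norm _).
Qed.

(** Weierstrass test: the partial sums are Cauchy because those of the nonnegative majorant [b]
    are. *)
Lemma nlim_series (t : nat -> X) (b : nat -> R) (K : R) :
  (forall n, nrm (t n) <= b n) -> (forall n, \sum_(i < n) b i <= K) ->
  exists l, nlim (fun n => \sum_(i < n) t i) l.
Proof.
move=> tb bK; case: (hX) => _ cX _; apply: cX => e e0.
have b0 n : 0 <= b n by apply: le_trans (tb n); exact: nrm_ge0.
pose S n : R := \sum_(i < n) b i.
have SS : nondecreasing_seq S.
  by apply/nondecreasing_seqP => n; rewrite /S big_ord_recr /= lerDl.
have : cvgn S by apply: nondecreasing_is_cvgn => //; exists K => _ [n _ <-]; exact: bK.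
move=> /cvgrPdist_lt/(_ _ (divr_gt0 e0 (ltr0n R 2)))[N _ hN].
have key m n : (n <= m)%N -> nrm (\sum_(i < m) t i - \sum_(i < n) t i) <= S m - S n.
  move=> nm; rewrite /S -!(big_mkord xpredT) (big_cat_nat (n := n))//=.
  rewrite [X in _ <= X - _](big_cat_nat (n := n))//=.
  have cancel_sum (G : zmodType) (x y : G) : x + y - x = y by rewrite addrC addKr.
  rewrite !cancel_sum (le_trans (nrm_sum _ _ _))//.
  by apply: ler_sum => i _.
have key2 m n : (n <= m)%N -> (N <= m)%N -> (N <= n)%N ->
    nrm (\sum_(i < m) t i - \sum_(i < n) t i) < e.
  move=> nm Nm Nn; apply: le_lt_trans (key _ _ nm) _.
  have := hN _ Nm; have := hN _ Nn; rewrite /= !ltr_norml => /andP[? ?] /andP[? ?]; lra.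
exists N => m n Nm Nn.
by have [nm|/ltnW mn] := leqP n m; [|rewrite nrmBC]; apply: key2.
Qed.

Lemma nlim_lipschitz (Y : algType R[i]) (nY : Y -> R) (f : X -> Y) (K : R) u l :
  (forall x y, nY (f x - f y) <= K * nrm (x - y)) -> nlim u l ->
  forall e : R, 0 < e -> exists N : nat, forall n, (N <= n)%N -> nY (f (u n) - f l) < e.
Proof.
move=> hf ul e e0; have K0 : 0 < `|K| + 1 by rewrite ltr_wpDl.
have [N hN] := ul _ (divr_gt0 e0 K0); exists N => n /hN h.
apply: le_lt_trans (hf _ _) _; rewrite ltr_pdivlMr// mulrC in h.
apply: le_lt_trans h; rewrite ler_wpM2r ?nrm_ge0//.
by rewrite (le_trans (ler_norm _))// lerDl.
Qed.

Lemma nlimMl a u l : nlim u l -> nlim (fun n => a * u n) (a * l).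
Proof.
move=> ul; apply: (@nlim_lipschitz X nrm ( *%R a) (nrm a)) ul => x y.
by rewrite -mulrBr nrmM.
Qed.

Lemma nlimMr a u l : nlim u l -> nlim (fun n => u n * a) (l * a).
Proof.
move=> ul; apply: (@nlim_lipschitz X nrm ( *%R^~ a) (nrm a)) ul => x y.
by rewrite -mulrBl (le_trans (nrmM _ _))// mulrC.
Qed.

(** Geometric series. The hypothesis is on the powers of a instead of its norm, so that a bound on
    the spectral radius suffices. *)
Lemma neumann a (K s : R) : 0 <= s < 1 -> (forall n, nrm (a ^+ n) <= K * s ^+ n) ->
  invertible (1 - a).
Proof.
move=> s01 ha; have /andP[s0 s1] := s01.
have K0 : 0 <= K by have := ha 0%N; rewrite !expr0 mulr1; apply: le_trans; exact: nrm_ge0.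
have [l hl] : exists l, nlim (fun n => \sum_(i < n) a ^+ i) l.
  apply: (nlim_series (b := fun n => K * s ^+ n) (K := K * (1 - s)^-1)) => // n.
  by rewrite -mulr_sumr ler_wpM2l// sum_geometric_le.
have h1 : nlim (fun n => 1 - a ^+ n) 1.
  apply: (nlim_bounded (b := fun n => K * s ^+ n)); last first.
    by move=> n; rewrite addrC addKr nrmN.
  rewrite -[X in _ --> X](mulr0 K); apply: cvgMr; apply: cvg_expr.
  by rewrite ger0_norm.
have E n : (1 - a) * (\sum_(i < n) a ^+ i) = 1 - a ^+ n.
  by rewrite -[LHS]opprK -mulNr opprB -subrX1 opprB.
have C n : GRing.comm (1 - a) (\sum_(i < n) a ^+ i).
  apply: commr_sum => i _; apply: commr_sym; apply: commrB; first exact: commr1.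
  by apply: commr_sym; exact: commrX.
exists l; split.
- apply: nlim_unique (nlimMl (1 - a) hl) _.
  by rewrite (_ : (fun n => _) = fun n => 1 - a ^+ n)//; apply/funext => n.
- apply: nlim_unique (nlimMr (1 - a) hl) _.
  by rewrite (_ : (fun n => _) = fun n => 1 - a ^+ n)//; apply/funext => n; rewrite -C.
Qed.
End NormedAlgebra.

(** * The unit circle and the function exp (it) *)

Section Cis.
Variable R : realType.
Implicit Types (s t : R) (n : nat).

Definition cis t : R[i] := Complex (cos t) (sin t).

Lemma cis0 : cis 0 = 1.
Proof. by rewrite /cis cos0 sin0. Qed.

Lemma cisD s t : cis (s + t) = cis s * cis t.
Proof.
rewrite /cis cosD sinD; apply/eqP; rewrite eq_complex /=.
by apply/andP; split; apply/eqP; ring.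
Qed.

Lemma cisX n t : cis (n%:R * t) = cis t ^+ n.
Proof.
elim: n => [|n IH]; first by rewrite mul0r cis0.
by rewrite -natr1 mulrDl mul1r cisD IH exprSr.
Qed.

Lemma modc_cis t : modc (cis t) = 1.
Proof. by rewrite /modc /= cos2Dsin2 sqrtr1. Qed.

Lemma modc_cis_sub1 t : modc (cis t - 1) <= `|t|.
Proof.
rewrite /modc /= oppr0 addr0 -sqrtr_sqr ler_sqrt ?sqr_ge0//.
have := one_sub_cos_le (normr_ge0 t); rewrite cos_norm real_normK ?num_real//.
have := cos2Dsin2 t; lra.
Qed.

Lemma cosC_cis t : ((2 * cos t)%:C)%C = cis t + cis (- t).
Proof.
rewrite /cis cosN sinN; apply/eqP; rewrite eq_complex /=.
by apply/andP; split; apply/eqP; ring.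
Qed.

Lemma modc_scaled_cis s t : 0 <= s <= 1 -> modc ((s%:C)%C * cis t - 1) <= `|t| + (1 - s).
Proof.
move=> /andP[s0 s1].
have -> : (s%:C)%C * cis t - 1 = (s%:C)%C * (cis t - 1) - ((1 - s)%:C)%C.
  by rewrite rmorphB rmorph1; ring.
apply: le_trans (modcD _ _) _; rewrite modcN modcM !modc_real.
rewrite (ger0_norm s0) ger0_norm ?subr_ge0// lerD2r.
have := modc_cis_sub1 t; have := modc_ge0 (cis t - 1); have := normr_ge0 t; nra.
Qed.
End Cis.

(** * Abel kernels and their averages over rotations *)

Section AbelKernel.
Variables (R : realType) (E : algType R[i]) (nrm : E -> R).
Hypothesis hE : unital_banach_algebra nrm.
Implicit Types (s t : R) (x y v w : E).

Lemma nrmZr t v : nrm ((t%:C)%C *: v) = `|t| * nrm v.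
Proof. by rewrite (nrmZ hE) modc_real. Qed.

(** Here v = w (1 - z x) v + (z - 1) w x v, and the hypothesis makes the last term at most half of
    |v|. So 1 - z x is bounded below for z near 1, without being inverted. *)
Lemma perturbed_lower_bound w x (z : R[i]) v : w * (1 - x) = 1 ->
  modc (z - 1) * (nrm x * nrm w) <= 2^-1 ->
  nrm v <= 2 * nrm w * nrm ((1 - z *: x) * v).
Proof.
move=> wx hz.
have vE : v = w * ((1 - z *: x) * v) + w * ((z - 1) *: (x * v)).
  rewrite -[LHS]mul1r -{1}wx -mulrDr -mulrA; congr (w * _).
  rewrite scalerBl scale1r scalerAl.
  ncring.
have h1 := nrmM hE w ((1 - z *: x) * v).
have h2 : nrm (w * ((z - 1) *: (x * v))) <= modc (z - 1) * (nrm x * nrm w) * nrm v.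
  apply: le_trans (nrmM hE _ _) _; rewrite (nrmZ hE) mulrCA -!mulrA.
  rewrite ler_wpM2l ?modc_ge0// [leRHS]mulrCA ler_wpM2l ?(nrm_ge0 hE)//.
  exact: nrmM.
have h3 : nrm v <= nrm w * nrm ((1 - z *: x) * v) + 2^-1 * nrm v.
  rewrite {1}vE; apply: le_trans (nrmD hE _ _) _; rewrite lerD//.
  by apply: le_trans h2 _; rewrite ler_wpM2r ?(nrm_ge0 hE).
rewrite -mulrA; lra.
Qed.

(** For p = s u, q = s u^-1 and c = s^2 this is the Poisson kernel: the sum of the p^n + q^n, minus
    1, equals (1 - s^2) / ((1 - p)(1 - q)) up to the tails of two geometric series cut off at L. *)
Lemma abel_kernel_identity (p q : E) (c : R[i]) L : p * q = c%:A -> q * p = c%:A ->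
  (1 - p) * ((1 - q) * (\sum_(n < L) (p ^+ n + q ^+ n) - 1)) =
  (1 - c)%:A - ((1 - q) * p ^+ L + (1 - p) * q ^+ L).
Proof.
move=> pq qp; set Sp := \sum_(n < L) p ^+ n; set Sq := \sum_(n < L) q ^+ n.
have geo (a : E) : (1 - a) * (\sum_(n < L) a ^+ n) = 1 - a ^+ L.
  by rewrite -[LHS]opprK -mulNr opprB -subrX1 opprB.
have AB : (1 - p) * (1 - q) = (1 - q) * (1 - p).
  apply: commrB; first exact: commr1.
  apply: commr_sym; apply: commrB; first exact: commr1.
  by rewrite /GRing.comm pq qp.
rewrite big_split /= -/Sp -/Sq.
have -> : (1 - p) * ((1 - q) * (Sp + Sq - 1)) =
    (1 - q) * ((1 - p) * Sp) + (1 - p) * ((1 - q) * Sq) - (1 - p) * (1 - q).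
  by move: AB; move: (1 - p) (1 - q) => A B AB; rewrite (mulrA B A) -AB; ncring.
rewrite /Sp /Sq !geo scalerBl scale1r -pq.
set P := p ^+ L; set Q := q ^+ L; ncring.
Qed.

(** With p = s e^(it) x and q = s e^(-it) x^-1, the product of (1 - p)(1 - q) and the kernel is 1 -
    s^2 plus a tail with the factor s^L. The smallness hypotheses bound 1 - p and 1 - q from below
    by [perturbed_lower_bound]. *)
Lemma abel_kernel_bound (x xi w wi : E) s t L :
  x * xi = 1 -> xi * x = 1 -> w * (1 - x) = 1 -> wi * (1 - xi) = 1 -> 0 < s < 1 ->
  (`|t| + (1 - s)) * (nrm x * nrm w) <= 2^-1 ->
  (`|t| + (1 - s)) * (nrm xi * nrm wi) <= 2^-1 ->
  nrm (\sum_(n < L) (cis (n%:R * t) *: ((s ^+ n)%:C%C *: x ^+ n) +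
                     cis (n%:R * - t) *: ((s ^+ n)%:C%C *: xi ^+ n)) - 1) <=
  2 * nrm w * (2 * nrm wi * ((1 - s ^+ 2) * nrm 1 +
    s ^+ L * ((1 + nrm xi) * nrm (x ^+ L) + (1 + nrm x) * nrm (xi ^+ L)))).
Proof.
move=> xxi xix wx wixi /andP[s0 s1] hx hxi.
have s01 : 0 <= s <= 1 by rewrite !ltW.
pose z := (s%:C)%C * cis t; pose zi := (s%:C)%C * cis (- t).
have hz : modc (z - 1) * (nrm x * nrm w) <= 2^-1.
  apply: le_trans hx; rewrite ler_wpM2r ?mulr_ge0 ?(nrm_ge0 hE)//.
  exact: modc_scaled_cis.
have hzi : modc (zi - 1) * (nrm xi * nrm wi) <= 2^-1.
  apply: le_trans hxi; rewrite ler_wpM2r ?mulr_ge0 ?(nrm_ge0 hE)//.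
  by rewrite -(normrN t); exact: modc_scaled_cis.
have pwE (a : R[i]) (v : E) n : (s%:C%C * a) ^+ n *: v ^+ n = a ^+ n *: (((s ^+ n)%:C)%C *: v ^+ n).
  by rewrite scalerA exprMn rmorphXn mulrC.
under eq_bigr do rewrite !cisX -!pwE -!exprZn.
rewrite -/z -/zi.
have zzi : z * zi = ((s ^+ 2)%:C)%C.
  by rewrite /z /zi mulrACA -cisD subrr cis0 mulr1 -rmorphM.
have pq : (z *: x) * (zi *: xi) = ((s ^+ 2)%:C%C)%:A.
  by rewrite -scalerAl -scalerAr scalerA zzi xxi.
have qp : (zi *: xi) * (z *: x) = ((s ^+ 2)%:C%C)%:A.
  by rewrite -scalerAl -scalerAr scalerA mulrC zzi xix.
have mz : modc z = s by rewrite /z modcM modc_cis modc_real mulr1 gtr0_norm.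
have mzi : modc zi = s by rewrite /zi modcM modc_cis modc_real mulr1 gtr0_norm.
have one_sub (a : R[i]) (v : E) (y : E) : modc a = s ->
    nrm ((1 - a *: v) * y) <= (1 + nrm v) * nrm y.
  move=> ha; rewrite mulrBl mul1r -scalerAl (le_trans (nrmB hE _ _))// mulrDl mul1r.
  rewrite lerD2l (nrmZ hE) ha -[leRHS]mul1r.
  by apply: ler_pM; [exact: ltW|exact: (nrm_ge0 hE)|exact: ltW|exact: (nrmM hE)].
have h := abel_kernel_identity L pq qp; set Q := \sum_(n < L) _ - 1 in h *.
have cPQ : (1 - zi *: xi) * ((1 - z *: x) * Q) = (1 - z *: x) * ((1 - zi *: xi) * Q).
  rewrite !mulrA; congr (_ * _); apply: commrB; first exact: commr1.
  apply: commr_sym; apply: commrB; first exact: commr1.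
  by rewrite /GRing.comm pq qp.
apply: le_trans (perturbed_lower_bound Q wx hz) _.
rewrite ler_wpM2l ?mulr_ge0 ?(nrm_ge0 hE)//.
apply: le_trans (perturbed_lower_bound _ wixi hzi) _.
rewrite ler_wpM2l ?mulr_ge0 ?(nrm_ge0 hE)// cPQ h.
apply: le_trans (nrmB hE _ _) _.
rewrite (nrmZ hE) -(rmorph1 (real_complex R)) -rmorphB modc_real ger0_norm; last first.
  by rewrite subr_ge0 exprn_ile1 ?ltW.
rewrite lerD2l mulrDr (le_trans (nrmD hE _ _))// !exprZn.
apply: lerD.
- apply: le_trans (one_sub zi xi _ mzi) _.
  by rewrite (nrmZ hE) modcX mz mulrCA.
- apply: le_trans (one_sub z x _ mz) _.
  by rewrite (nrmZ hE) modcX mzi mulrCA.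
Qed.

(** As 2 cos (n b) e^(int) = e^(in(t+b)) + e^(in(t-b)), a factor cos (n b) averages the kernels
    rotated by b and by -b. The total rotation stays within |t| plus the sum of [bs], and the
    constant term -1 is its own average. *)
Lemma cos_average_bound (X Y : nat -> E) L (K eps : R) :
  (forall t, `|t| <= eps ->
    nrm (\sum_(n < L) (cis (n%:R * t) *: X n + cis (n%:R * - t) *: Y n) - 1) <= K) ->
  forall (bs : seq R) t, {in bs, forall b, 0 <= b} -> `|t| + \sum_(b <- bs) b <= eps ->
  nrm (\sum_(n < L) ((\prod_(b <- bs) cos (n%:R * b))%:C)%C *:
        (cis (n%:R * t) *: X n + cis (n%:R * - t) *: Y n) - 1) <= K.
Proof.
move=> hK; elim=> [|b bs IH] t hbs.
  rewrite big_nil addr0 => /hK; congr (nrm (_ - _) <= _).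
  by apply: eq_bigr => n _; rewrite big_nil scale1r.
rewrite big_cons => ht.
have b0 : 0 <= b by apply: hbs; rewrite mem_head.
have hbs' : {in bs, forall b, 0 <= b} by move=> c hc; apply: hbs; rewrite in_cons hc orbT.
have h1 := IH (t + b) hbs' _; have h2 := IH (t - b) hbs' _.
pose S u := \sum_(n < L) ((\prod_(b <- bs) cos (n%:R * b))%:C)%C *:
        (cis (n%:R * u) *: X n + cis (n%:R * - u) *: Y n) - 1.
have {}h1 : nrm (S (t + b)) <= K.
  apply: h1; apply: le_trans ht; rewrite addrA lerD2r (le_trans (ler_normD _ _))//.
  by rewrite (ger0_norm b0).
have {}h2 : nrm (S (t - b)) <= K.
  apply: h2; apply: le_trans ht; rewrite addrA lerD2r (le_trans (ler_normB _ _))//.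
  by rewrite (ger0_norm b0).
have -> : \sum_(n < L) ((\prod_(j <- b :: bs) cos (n%:R * j))%:C)%C *:
        (cis (n%:R * t) *: X n + cis (n%:R * - t) *: Y n) - 1 =
    (2^-1)%:C%C *: (S (t + b) + S (t - b)).
  apply: (@scalerI _ _ (2%:C)%C).
    by rewrite -(rmorph0 (real_complex R)) (inj_eq (@complexI R)) pnatr_eq0.
  rewrite scalerA -rmorphM divff ?pnatr_eq0// rmorph1 scale1r /S.
  rewrite addrACA -big_split /= scalerBr scaler_sumr; congr (_ + _); last first.
    by rewrite rmorphMn /= rmorph1 scaler_nat mulr2n opprD.
  apply: eq_bigr => n _; rewrite big_cons rmorphM /= -scalerDr scalerA mulrA -rmorphM /=.
  rewrite cosC_cis mulrC -scalerA; congr (_ *: _).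
  rewrite scalerDr !scalerA addrACA -!scalerDl.
  by congr (_ *: _ + _ *: _); rewrite ?opprD ?opprK !mulrDr ?mulrN !cisD; ring.
rewrite nrmZr ger0_norm ?invr_ge0// mulrC ler_pdivrMr//.
apply: le_trans (nrmD hE _ _) _; lra.
Qed.

(** Only finitely many coefficients occur, so [d] may be replaced by a finite product of cosines up
    to an arbitrarily small error, and the averaged bound at t = 0 applies. *)
Lemma abel_mean_bound (x xi w wi : E) (s eps : R) L (d : nat -> R) (bs : nat -> seq R) :
  x * xi = 1 -> xi * x = 1 -> w * (1 - x) = 1 -> wi * (1 - xi) = 1 -> 0 < s < 1 ->
  (eps + (1 - s)) * (nrm x * nrm w) <= 2^-1 ->
  (eps + (1 - s)) * (nrm xi * nrm wi) <= 2^-1 ->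
  (forall del : R, 0 < del -> exists M, forall n, (n < L)%N ->
     `|d n - \prod_(b <- bs M) cos (n%:R * b)| <= del) ->
  (forall M, {in bs M, forall b, 0 <= b} /\ \sum_(b <- bs M) b <= eps) ->
  nrm (\sum_(n < L) ((d n * s ^+ n)%:C)%C *: (x ^+ n + xi ^+ n) - 1) <=
  2 * nrm w * (2 * nrm wi * ((1 - s ^+ 2) * nrm 1 +
    s ^+ L * ((1 + nrm xi) * nrm (x ^+ L) + (1 + nrm x) * nrm (xi ^+ L)))).
Proof.
move=> xxi xix wx wixi s01 hx hxi dlim hbs; have /andP[s0 s1] := s01.
set KK := leRHS.
have hK t : `|t| <= eps -> nrm (\sum_(n < L) (cis (n%:R * t) *: ((s ^+ n)%:C%C *: x ^+ n) +
    cis (n%:R * - t) *: ((s ^+ n)%:C%C *: xi ^+ n)) - 1) <= KK.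
  move=> ht; apply: abel_kernel_bound => //.
    by apply: le_trans hx; rewrite ler_wpM2r ?mulr_ge0 ?(nrm_ge0 hE)// lerD2r.
  by apply: le_trans hxi; rewrite ler_wpM2r ?mulr_ge0 ?(nrm_ge0 hE)// lerD2r.
have hM M : nrm (\sum_(n < L) ((\prod_(b <- bs M) cos (n%:R * b) * s ^+ n)%:C)%C *:
    (x ^+ n + xi ^+ n) - 1) <= KK.
  have [hb1 hb2] := hbs M.
  have := @cos_average_bound (fun n => (s ^+ n)%:C%C *: x ^+ n)
    (fun n => (s ^+ n)%:C%C *: xi ^+ n) L KK eps hK (bs M) 0 hb1.
  rewrite normr0 add0r => /(_ hb2); congr (nrm (_ - _) <= _).
  apply: eq_bigr => n _; rewrite oppr0 mulr0 cis0 !scale1r -scalerDr scalerA.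
  by rewrite -rmorphM.
pose T := \sum_(n < L) nrm (x ^+ n + xi ^+ n).
have T0 : 0 <= T by apply: sumr_ge0 => n _; exact: nrm_ge0.
apply/ler_addgt0Pr => del del0.
have [M hdM] := dlim _ (divr_gt0 del0 (ltr_wpDl T0 ltr01)).
apply: le_trans (lerD (hM M) (lexx _)).
rewrite -lerBlDl; apply: le_trans (_ : nrm (\sum_(n < L)
    ((d n - \prod_(b <- bs M) cos (n%:R * b))%:C%C * (s ^+ n)%:C%C) *: (x ^+ n + xi ^+ n)) <= _).
  rewrite lerBlDl; apply: le_trans (nrmD hE _ _); rewrite le_eqVlt; apply/orP; left.
  apply/eqP; congr nrm; rewrite addrAC -big_split /=; congr (_ - _).
  by apply: eq_bigr => n _; rewrite -scalerDl -!rmorphM -rmorphD -mulrDl subrKC.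
apply: le_trans (nrm_sum hE _ _ _) _.
apply: (@le_trans _ _ (\sum_(n < L) del / (T + 1) * nrm (x ^+ n + xi ^+ n))).
  apply: ler_sum => n _; rewrite -rmorphM nrmZr ler_wpM2r ?(nrm_ge0 hE)//.
  rewrite normrM -[leRHS]mulr1 ler_pM// ?hdM//.
  by rewrite ger0_norm ?exprn_ge0 ?exprn_ile1 ?ltW.
rewrite -mulr_sumr -/T mulrAC ler_pdivrMr ?ltr_wpDl// ler_wpM2l ?ltW//.
by rewrite ltrDl.
Qed.
End AbelKernel.

(** * Bump functions of an element whose powers grow subexponentially *)

Section Core.
Variables (R : realType) (U E : algType R[i]) (nU : U -> R) (nE : E -> R) (phi : U -> E).
Hypotheses (hU : unital_banach_algebra nU) (hE : unital_banach_algebra nE).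
Hypothesis hphi : cont_unital_hom nU nE phi.
Implicit Types (x y : U) (c : R[i]).

Lemma phiP c x y : phi (c *: x + y) = c *: phi x + phi y.
Proof. by case: hphi => h _ _ _; exact: h. Qed.

Lemma phiM x y : phi (x * y) = phi x * phi y.
Proof. by case: hphi => _ h _ _; exact: h. Qed.

Lemma phi1 : phi 1 = 1.
Proof. by case: hphi. Qed.

Lemma phiD x y : phi (x + y) = phi x + phi y.
Proof. by have := phiP 1 x y; rewrite !scale1r. Qed.

Lemma phi0 : phi 0 = 0.
Proof. by apply: (addIr (phi 0)); rewrite -phiD !add0r. Qed.

Lemma phiZ c x : phi (c *: x) = c *: phi x.
Proof. by have := phiP c x 0; rewrite phi0 !addr0. Qed.

Lemma phiB x y : phi (x - y) = phi x - phi y.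
Proof. by rewrite -scaleN1r addrC phiP scaleN1r addrC. Qed.

Lemma phi_sum (I : Type) (s : seq I) (F : I -> U) :
  phi (\sum_(i <- s) F i) = \sum_(i <- s) phi (F i).
Proof. exact: (big_morph phi phiD phi0). Qed.

Lemma phiX x n : phi (x ^+ n) = phi x ^+ n.
Proof. by elim: n => [|n IH]; rewrite ?expr0 ?phi1// !exprS phiM IH. Qed.

Lemma phi_invertible x : invertible x -> invertible (phi x).
Proof. by move=> [y [xy yx]]; exists (phi y); rewrite -!phiM xy yx phi1. Qed.

Lemma phi_bounded : exists2 K : R, 0 < K & forall x, nE (phi x) <= K * nU x.
Proof.
case: hphi => _ _ _ /(_ 0 1 ltr01)[d d0 hd].
exists (2 / d) => [|x]; first by rewrite divr_gt0.
have [->|x0] := eqVneq x 0; first by rewrite phi0 (nrm0 hE) (nrm0 hU) mulr0.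
have nx : 0 < nU x.
  by rewrite lt0r (nrm_ge0 hU) andbT; apply: contra_neq x0; exact: (nrm_eq0 hU).
have t0 : 0 < d / (2 * nU x) by rewrite divr_gt0// mulr_gt0.
have := hd ((d / (2 * nU x))%:C%C *: x).
rewrite phi0 !subr0 phiZ (nrmZr hE) (nrmZr hU) gtr0_norm//.
have -> : d / (2 * nU x) * nU x = d / 2 by field; rewrite gt_eqF.
move=> /(_ _)/ltW h; have {}h : d / (2 * nU x) * nE (phi x) <= 1 by apply: h; lra.
have -> : 2 / d * nU x = (d / (2 * nU x))^-1 by field; rewrite !gt_eqF.
by rewrite -[leRHS]mul1r ler_pdivlMr// mulrC.
Qed.

Lemma invertible_modM x y : invertible_mod (ker_of phi) x ->
  invertible_mod (ker_of phi) y -> invertible_mod (ker_of phi) (x * y).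
Proof.
rewrite /invertible_mod /ker_of /= => -[a [xa ax]] [b [yb by_]].
move: xa ax yb by_; rewrite !phiB !phiM phi1.
move=> /subr0_eq xa /subr0_eq ax /subr0_eq yb /subr0_eq by_.
exists (b * a); rewrite !phiB !phiM phi1; split; apply/eqP; rewrite subr_eq0; apply/eqP.
  by rewrite mulrA -(mulrA (phi x)) yb mulr1.
by rewrite mulrA -(mulrA (phi b)) ax mulr1.
Qed.

(* The partial sums F_L(u) of a bump function at 1 converge to D + (1 - u) Y with
   D <> 0; in E they tend to 0, because they are averages of Abel kernels, which
   vanish near points of the resolvent set of phi u. *)
Lemma subexp_invertible_mod (k : nat) (r : R) (u ui : U) :
  (1 < k)%N -> 1 < r < k%:R -> u * ui = 1 -> ui * u = 1 ->
  subexp k r (fun n => nU (u ^+ n)) -> subexp k r (fun n => nU (ui ^+ n)) ->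
  invertible (phi (1 - u)) -> invertible_mod (ker_of phi) (1 - u).
Proof.
move=> k1 r1 uui uiu su sui; rewrite phiB phi1; set x := phi u => -[w [_ wx]].
(* As 1 - x^-1 = -x^-1 (1 - x), its inverse is -w x. *)
pose xi := phi ui; pose wi := - (w * x).
have xxi : x * xi = 1 by rewrite -phiM uui phi1.
have xix : xi * x = 1 by rewrite -phiM uiu phi1.
have wixi : wi * (1 - xi) = 1.
  by rewrite /wi mulrBr mulr1 mulNr -mulrA xxi mulr1 opprK addrC -wx mulrBr mulr1.
have [K0 K00 hK0] := phi_bounded.
pose Z := nE x * nE w + nE xi * nE wi + 1.
have nxw : 0 <= nE x * nE w by rewrite mulr_ge0// (nrm_ge0 hE).
have nxwi : 0 <= nE xi * nE wi by rewrite mulr_ge0// (nrm_ge0 hE).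
have Z0 : 0 < Z by rewrite /Z; lra.
(* Below, 1 - s <= eps, and 2 eps Z = 1/2 is the smallness that [abel_mean_bound] asks for. *)
pose eps := (4 * Z)^-1.
have eps0 : 0 < eps by rewrite invr_gt0 mulr_gt0.
pose e n : R := \big[Num.max/0]_(i < n.+1) Num.max (nU (u ^+ i)) (nU (ui ^+ i)).
have r0 : 0 <= r by lra.
have se : subexp k r e := subexp_bigmax (subexp_max r0 su sui).
have e_ge0 n : 0 <= e n by exact: bigmax_ge_id.
have e_u i n : (i <= n)%N -> nU (u ^+ i) <= e n.
  by move=> ni; apply: (bigmax_sup (Ordinal (ni : (i < n.+1)%N))) => //=; rewrite le_max lexx.
have e_ui i n : (i <= n)%N -> nU (ui ^+ i) <= e n.
  by move=> ni; apply: (bigmax_sup (Ordinal (ni : (i < n.+1)%N))) => //=; rewrite le_max lexx orbT.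
have [d [bs [d0 d_ge0 dlim hbs [K1 hK1]]]] := bump_coefs k1 r1 se e_ge0 eps0.
have K10 : 0 <= K1 by apply: le_trans (hK1 0%N); rewrite !mulr_ge0.
have de_le n : d n * e n * n.+1%:R <= K1 * n.+1%:R ^- 2.
  by rewrite ler_pdivlMr ?exprn_gt0// -[leLHS]mulrA -exprS.
have sum_le n : \sum_(i < n) K1 * i.+1%:R ^- 2 <= K1 * 2.
  by rewrite -mulr_sumr ler_wpM2l// sum_inv_sqr_le.
have n1U : 0 < nU 1.
  rewrite lt0r (nrm_ge0 hU) andbT; apply/eqP => /(nrm_eq0 hU)/eqP.
  by rewrite oner_eq0.
(* [y n] is the quotient of u^n + u^-n - 2 by 1 - u; see [ynE]. *)
pose y n := ui * (\sum_(i < n) ui ^+ i) - \sum_(i < n) u ^+ i.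
pose Y L := \sum_(n < L) ((d n)%:C)%C *: y n.
have [Yl hYl] : exists l, nlim nU Y l.
  apply: (nlim_series hU (t := fun n => ((d n)%:C)%C *: y n)
    (b := fun n => (1 + nU ui) * (K1 * n.+1%:R ^- 2))
    (K := (1 + nU ui) * (K1 * 2))); last first.
    by move=> n; rewrite -mulr_sumr ler_wpM2l ?addr_ge0 ?(nrm_ge0 hU).
  move=> n; rewrite (nrmZr hU) ger0_norm//.
  have s1 : nU (\sum_(i < n) u ^+ i) <= n.+1%:R * e n.
    apply: le_trans (nrm_sum hU _ _ _) _; rewrite (@le_trans _ _ (\sum_(i < n) e n))//.
      by apply: ler_sum => i _; apply: e_u; exact: ltnW.
    by rewrite sumr_const card_ord -[_ *+ n]mulr_natl ler_wpM2r// ler_nat.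
  have s2 : nU (\sum_(i < n) ui ^+ i) <= n.+1%:R * e n.
    apply: le_trans (nrm_sum hU _ _ _) _; rewrite (@le_trans _ _ (\sum_(i < n) e n))//.
      by apply: ler_sum => i _; apply: e_ui; exact: ltnW.
    by rewrite sumr_const card_ord -[_ *+ n]mulr_natl ler_wpM2r// ler_nat.
  apply: (@le_trans _ _ ((1 + nU ui) * (d n * e n * n.+1%:R))); last first.
    by rewrite ler_wpM2l ?addr_ge0 ?(nrm_ge0 hU).
  have -> : (1 + nU ui) * (d n * e n * n.+1%:R) =
     d n * (nU ui * (n.+1%:R * e n) + n.+1%:R * e n) by ring.
  rewrite ler_wpM2l// (le_trans (nrmB hU _ _))// lerD//.
  by rewrite (le_trans (nrmM hU _ _))// ler_wpM2l ?(nrm_ge0 hU).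
(* [D L] is the value at u = 1 of the partial sum F_L. It is at least 1 for L > 0, because d 0 = 1
   and all d n >= 0. *)
pose D L : R := 2 * (\sum_(n < L) d n) - 1.
have [Dl D1 hD] : exists2 Dl : R, 1 <= Dl & D @ \oo --> Dl.
  have Dnd : nondecreasing_seq D.
    apply/nondecreasing_seqP => n; rewrite /D big_ord_recr /=; have := d_ge0 n; lra.
  have Dcvg : cvgn D.
    apply: nondecreasing_is_cvgn => //; exists (2 * (K1 * 2 / nU 1)) => _ [n _ <-].
    apply: (@le_trans _ _ (2 * \sum_(i < n) d i)); first by rewrite /D gerBl.
    rewrite ler_wpM2l// ler_pdivlMr// mulr_suml (le_trans _ (sum_le n))//.
    apply: ler_sum => i _; apply: le_trans (de_le i); rewrite -mulrA ler_wpM2l//.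
    rewrite (le_trans (e_u 0%N i _))// ler_peMr// (ler_nat _ 1)//.
  exists (limn D) => //.
  apply: limr_ge => //; exists 1%N => // -[|n]//= _.
  rewrite /D big_ord_recl /= d0; have : 0 <= \sum_(i < n) d (bump 0 i) by apply: sumr_ge0.
  lra.
pose F L := \sum_(n < L) ((d n)%:C)%C *: (u ^+ n + ui ^+ n) - 1.
have ynE n : u ^+ n + ui ^+ n = 2%:A + (1 - u) * y n.
  have geo (a : U) : (1 - a) * (\sum_(i < n) a ^+ i) = 1 - a ^+ n.
    by rewrite -[LHS]opprK -mulNr opprB -subrX1 opprB.
  rewrite /y mulrBr geo mulrA.
  have -> : (1 - u) * ui = - (1 - ui) by rewrite mulrBl mul1r uui opprB.
  rewrite mulNr geo scaler_nat mulr2n; zmod.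
have yC n : GRing.comm (1 - u) (y n).
  have uC : GRing.comm u ui by rewrite /GRing.comm uui uiu.
  apply: commr_sym; apply: commrB; first exact: commr1; apply: commr_sym.
  apply: commrB; first apply: commrM => //; apply: commr_sum => i _; exact: commrX.
have FE L : F L = ((D L)%:C%C)%:A + (1 - u) * Y L.
  rewrite /F /Y /D rmorphB rmorph1 scalerBl scale1r addrAC; congr (_ - _).
  rewrite !mulr_sumr rmorph_sum /= scaler_suml -big_split /=.
  apply: eq_bigr => n _; rewrite ynE scalerDr scalerA -scalerAr; congr (_ *: _ + _).
  by rewrite mulrC rmorphM /= rmorphMn rmorph1.
have F0 : nlim nE (fun L => phi (F L)) 0.
  have Tn n : nE (x ^+ n + xi ^+ n) <= 2 * K0 * e n.
    apply: le_trans (nrmD hE _ _) _; rewrite -!phiX.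
    have := hK0 (u ^+ n); have := hK0 (ui ^+ n).
    have := e_u n n (leqnn _); have := e_ui n n (leqnn _).
    have := nrm_ge0 hU (u ^+ n); have := nrm_ge0 hU (ui ^+ n); nra.
  move=> eta eta0.
  pose W := 2 * nE w * (2 * nE wi); pose C2 := (1 + nE xi) + (1 + nE x).
  have W0 : 0 <= W by rewrite !mulr_ge0// (nrm_ge0 hE).
  have C20 : 0 <= C2 by rewrite !addr_ge0// (nrm_ge0 hE).
  pose C3 := 4 * (W * nE 1) + 2 * (4 * K0 * K1) + 1.
  have C30 : 0 < C3.
    by rewrite ltr_wpDl// addr_ge0// !mulr_ge0// ?(nrm_ge0 hE)// ltW.
  (* The three bounds on [h] keep [sg] at least 1/2, keep 1 - s at most [eps], and make the part of
     the estimate independent of L at most eta / 2. *)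
  pose h := Num.min 2^-1 (Num.min (eps / 2) (eta / 2 / C3)).
  have h0 : 0 < h by rewrite !lt_min invr_gt0 ltr0n !divr_gt0.
  have [h1 h2 h3] : [/\ h <= 2^-1, h <= eps / 2 & h * C3 <= eta / 2].
    by rewrite -ler_pdivlMr// !ge_min !lexx !orbT.
  (* Since s^L = sg^L sg^L, one factor compensates the growth of [e L] and the other sends the tail
     to 0. *)
  pose sg := 1 - h; pose s := sg ^+ 2.
  have sg01 : 0 < sg < 1 by apply/andP; split; rewrite /sg; lra.
  have /andP[sg0 sg1] := sg01.
  have s01 : 0 < s < 1 by rewrite exprn_gt0// exprn_ilt1// ltW.
  have /andP[s0 s1] := s01.
  have s_h : 1 - s <= 2 * h by rewrite /s /sg; have := sqr_ge0 h; lra.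
  have s2_h : 1 - s ^+ 2 <= 4 * h by nra.
  have [K2 hK2] := subexp_geometric k1 r1 se e_ge0 sg01.
  have K20 : 0 <= K2 by apply: le_trans (hK2 0%N); rewrite expr0 mul1r.
  have sgV : 1 < sg^-1 by rewrite invf_gt1.
  have [N hN] := expr_ge_eventually ((W * (C2 * K0 * K2) + 1) / (eta / 2)) sgV.
  exists N => L NL; rewrite subr0.
  have epsZ : 2 * eps * Z = 2^-1 by rewrite /eps; field; rewrite gt_eqF.
  have hh a : 0 <= a -> a <= Z -> (eps + (1 - s)) * a <= 2^-1.
    move=> a0 aZ; apply: (@le_trans _ _ (2 * eps * Z)); last by rewrite epsZ.
    rewrite ler_pM//; lra.
  have nxwZ : nE x * nE w <= Z by rewrite /Z; lra.
  have nxwiZ : nE xi * nE wi <= Z by rewrite /Z; lra.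
  have A1 := abel_mean_bound hE xxi xix wx wixi s01
    (hh _ nxw nxwZ) (hh _ nxwi nxwiZ) (dlim L) hbs.
  set S1 := \sum_(n < L) _ - 1 in A1.
  (* The first part carries the Abel weights s^n. In the second, 1 - s^n <= n (1 - s), and the sum
     of the n d n e n is finite. *)
  have FS : phi (F L) = S1 + \sum_(n < L) ((d n * (1 - s ^+ n))%:C%C) *: (x ^+ n + xi ^+ n).
    rewrite /F /S1 phiB phi_sum phi1 addrAC -big_split /=; congr (_ - _).
    apply: eq_bigr => n _; rewrite phiZ phiD !phiX -scalerDl -rmorphD /= -mulrDr.
    by rewrite subrKC mulr1.
  have A2 : nE (\sum_(n < L) ((d n * (1 - s ^+ n))%:C%C) *: (x ^+ n + xi ^+ n)) <=
      2 * h * (4 * K0 * K1).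
    apply: le_trans (nrm_sum hE _ _ _) _.
    apply: (@le_trans _ _ (\sum_(n < L) 2 * h * (2 * K0) * (K1 * n.+1%:R ^- 2))); last first.
      rewrite -mulr_sumr (_ : _ * (4 * _ * _) = 2 * h * (2 * K0) * (K1 * 2)); last by ring.
      by rewrite ler_wpM2l// !mulr_ge0// ltW.
    apply: ler_sum => n _; rewrite (nrmZr hE).
    have /andP[sn0 sn1] : 0 <= 1 - s ^+ n <= n%:R * (1 - s) by apply: one_sub_expr_le; rewrite !ltW.
    rewrite ger0_norm ?mulr_ge0//.
    apply: (@le_trans _ _ (2 * h * (2 * K0) * (d n * e n * n.+1%:R))); last first.
      by rewrite ler_wpM2l// !mulr_ge0// ltW.
    have -> : 2 * h * (2 * K0) * (d n * e n * n.+1%:R) =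
        d n * (n.+1%:R * (2 * h)) * (2 * K0 * e n) by ring.
    apply: ler_pM (Tn n); rewrite ?mulr_ge0 ?(nrm_ge0 hE)//.
    apply: ler_wpM2l => //; apply: le_trans sn1 _.
    by apply: ler_pM; rewrite ?ler_nat ?subr_ge0// ltW.
  have A3 : (1 + nE xi) * nE (x ^+ L) + (1 + nE x) * nE (xi ^+ L) <= C2 * (K0 * e L).
    rewrite /C2 [leRHS]mulrDl; apply: lerD; rewrite ler_wpM2l ?addr_ge0 ?(nrm_ge0 hE)//.
      by rewrite -phiX (le_trans (hK0 _))// ler_wpM2l ?(ltW K00)// e_u.
    by rewrite -phiX (le_trans (hK0 _))// ler_wpM2l ?(ltW K00)// e_ui.
  have sgL : 0 < sg ^+ L by rewrite exprn_gt0.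
  have A4 : s ^+ L * (C2 * (K0 * e L)) <= sg ^+ L * (C2 * K0 * K2).
    have -> : s ^+ L * (C2 * (K0 * e L)) = sg ^+ L * (C2 * K0 * (sg ^+ L * e L)).
      by rewrite /s -exprM mulnC exprM expr2; ring.
    by rewrite ler_wpM2l ?(ltW sgL)// ler_wpM2l// mulr_ge0// ltW.
  have A5 : sg ^+ L * (W * (C2 * K0 * K2)) < eta / 2.
    have := hN _ NL; rewrite exprVn ler_pdivrMr ?divr_gt0//.
    rewrite [leRHS]mulrC ler_pdivlMr// => A5; apply: lt_le_trans A5.
    by rewrite mulrC ltr_pM2r// ltrDl.
  have A6 : nE S1 <= 4 * h * (W * nE 1) + sg ^+ L * (W * (C2 * K0 * K2)).
    apply: le_trans A1 _; rewrite mulrA -/W mulrDr; apply: lerD.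
      rewrite [leLHS]mulrCA; apply: ler_wpM2r s2_h.
      by rewrite mulr_ge0// (nrm_ge0 hE).
    rewrite [leRHS]mulrCA; apply: ler_wpM2l => //; apply: le_trans A4.
    by apply: ler_wpM2l => //; rewrite exprn_ge0// ltW.
  rewrite FS; apply: le_lt_trans (nrmD hE _ _) _.
  have A8 : h * C3 = 4 * h * (W * nE 1) + 2 * h * (4 * K0 * K1) + h by rewrite /C3; ring.
  move: A2 A5 A6 A8 h3 h0; clear => *; lra.
have limD : nlim nE (fun L => ((D L)%:C%C)%:A) ((Dl%:C%C)%:A).
  move=> eta eta0; have n1 : 0 < nE 1 + 1 by rewrite ltr_wpDl// (nrm_ge0 hE).
  move/cvgrPdist_lt: hD => /(_ _ (divr_gt0 eta0 n1))[N _ hN]; exists N => n Nn.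
  have := hN _ Nn; rewrite ltr_pdivlMr// distrC => h.
  rewrite -scalerBl -rmorphB (nrmZr hE) (le_lt_trans _ h)// ler_wpM2l// lerDl//.
have limY : nlim nE (fun L => phi (Y L)) (phi Yl).
  apply: (@nlim_lipschitz _ _ _ hU _ nE phi K0 _ _ _ hYl) => a b.
  by rewrite -phiB; exact: hK0.
(* The limit of [FE] is taken with 1 - x on the left, then on the right; so -Yl / Dl is a two-sided
   inverse of 1 - u modulo the kernel. *)
have eq0 : (Dl%:C%C)%:A + (1 - x) * phi Yl = 0.
  apply: (nlim_unique hE _ F0); have := nlimD hE limD (nlimMl hE (1 - x) limY).
  rewrite (_ : (fun n => _) = (fun L => phi (F L)))//; apply/funext => L.
  by rewrite FE phiD phiZ phiM phiB !phi1.
have eq0' : (Dl%:C%C)%:A + phi Yl * (1 - x) = 0.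
  apply: (nlim_unique hE _ F0); have := nlimD hE limD (nlimMr hE (1 - x) limY).
  rewrite (_ : (fun n => _) = (fun L => phi (F L)))//; apply/funext => L.
  rewrite FE phiD phiZ phi1 -(phi1) -phiB -phiM; congr (_ + phi _).
  rewrite /Y mulr_suml mulr_sumr; apply: eq_bigr => n _.
  by rewrite -scalerAl -scalerAr yC.
have DlC : (Dl%:C)%C != 0 :> R[i].
  by rewrite -(rmorph0 (real_complex R)) (inj_eq (@complexI R)) gt_eqF//; lra.
exists (- (Dl%:C%C)^-1 *: Yl); rewrite /ker_of /=; split.
- rewrite phiB phi1 -scalerAr phiZ phiM phiB phi1.
  rewrite (_ : (1 - x) * _ = - (Dl%:C%C)%:A); last by apply/eqP; rewrite -addr_eq0 addrC eq0.
  by rewrite scaleNr scalerN opprK scalerA mulVf// scale1r subrr.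
- rewrite phiB phi1 -scalerAl phiZ phiM phiB phi1.
  rewrite (_ : _ * (1 - x) = - (Dl%:C%C)%:A); last by apply/eqP; rewrite -addr_eq0 addrC eq0'.
  by rewrite scaleNr scalerN opprK scalerA mulVf// scale1r subrr.
Qed.
End Core.

(** * Subexponential growth of powers from the differential inequality *)

Section Growth.
Variables (R : realType) (U : algType R[i]) (nU : U -> R).
Hypothesis hU : unital_banach_algebra nU.

(** The logarithms l_i of the maxima satisfy l_(i+1) <= ln C + r l_i, so they are O(r^i). Other
    exponents are expanded in base k, with fewer than k factors z^(k^m) for each digit. *)
Lemma power_recursion_subexp (k : nat) (r C : R) (z : U) :
  1 < r -> 1 <= C ->
  (forall i, Num.max 1 (nU (z ^+ (k ^ i.+1))) <= C * Num.max 1 (nU (z ^+ (k ^ i))) `^ r) ->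
  subexp k r (fun n => nU (z ^+ n)).
Proof.
move=> r1 C1 hz; have r0 : 0 < r - 1 by lra.
pose X i := Num.max 1 (nU (z ^+ (k ^ i))).
have X1 i : 1 <= X i by rewrite le_max lexx.
have XU i : nU (z ^+ (k ^ i)) <= X i by rewrite le_max lexx orbT.
have X0 i : 0 < X i by apply: lt_le_trans (X1 i).
(* As ln C = c1 (r - 1), the map l -> ln C + r l sends c0 r^i - c1 to c0 r^(i+1) - c1. *)
pose c1 := ln C / (r - 1); pose c0 := ln (X 0%N) + c1.
have c10 : 0 <= c1 by rewrite divr_ge0 ?ln_ge0 ?(ltW r0).
have c00 : 0 <= c0 by rewrite addr_ge0// ln_ge0.
have hX i : X i <= expR (c0 * r ^+ i - c1).
  elim: i => [|i IH].
    by rewrite expr0 mulr1 addrK lnK// posrE.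
  apply: le_trans (hz i) _; rewrite -/(X i).
  apply: (@le_trans _ _ (C * (expR (c0 * r ^+ i - c1)) `^ r)).
    rewrite ler_wpM2l ?(le_trans ler01)// ge0_ler_powR ?nnegrE ?expR_ge0 ?(ltW (X0 i))//.
    lra.
  rewrite -expRM -{1}[C]lnK ?posrE ?(lt_le_trans ltr01)// -expRD ler_expR.
  have -> : ln C = c1 * (r - 1) by rewrite /c1 divfK// gt_eqF.
  by rewrite exprSr; lra.
have {}hX i : X i <= expR (c0 * r ^+ i).
  by apply: le_trans (hX i) _; rewrite ler_expR; lra.
(* The induction on m needs k c0 + c2 <= c2 r; the logarithm settles n = 0. *)
pose c2 := k%:R * c0 / (r - 1) + ln (Num.max 1 (nU 1)).
have m11 : 1 <= Num.max 1 (nU 1) by rewrite le_max lexx.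
have kc0 : 0 <= k%:R * c0 / (r - 1) by rewrite divr_ge0 ?mulr_ge0 ?(ltW r0).
have c20 : 0 <= c2 by rewrite addr_ge0 ?ln_ge0.
have rm0 m : 0 <= r ^+ m by rewrite exprn_ge0//; lra.
exists c2 => //; elim=> [|m IH] n.
  rewrite expn0 ltnS leqn0 => /eqP ->; rewrite !expr0 mulr1.
  apply: (@le_trans _ _ (Num.max 1 (nU 1))); first by rewrite le_max lexx orbT.
  rewrite -[leLHS]lnK ?posrE ?(lt_le_trans ltr01)// ler_expR lerDr//.
move=> nm; have [k0|k0] := posnP k; first by move: nm; rewrite k0 exp0n.
have km0 : (0 < k ^ m)%N by rewrite expn_gt0 k0.
have qk : (n %/ k ^ m < k)%N by rewrite ltn_divLR// -expnS.
rewrite (divn_eq n (k ^ m)) exprD mulnC exprM.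
apply: le_trans (nrmXM hU _ _ _) _.
apply: (@le_trans _ _ (expR (c0 * r ^+ m) ^+ k * expR (c2 * r ^+ m))).
  apply: ler_pM; rewrite ?exprn_ge0 ?(nrm_ge0 hU)//; last by apply: IH; rewrite ltn_mod.
  apply: (@le_trans _ _ (X m ^+ (n %/ k ^ m))).
    by rewrite lerXn2r ?nnegrE ?(nrm_ge0 hU) ?(ltW (X0 m)).
  apply: (@le_trans _ _ (X m ^+ k)); first by rewrite ler_weXn2l// ltnW.
  by rewrite lerXn2r ?nnegrE ?expR_ge0 ?(ltW (X0 m)).
rewrite -expRM_natl -expRD ler_expR exprS mulrA -mulrDl mulrA ler_wpM2r//.
have : k%:R * c0 = (k%:R * c0 / (r - 1)) * (r - 1) by rewrite divfK// gt_eqF.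
have : 0 <= ln (Num.max 1 (nU 1)) by rewrite ln_ge0.
rewrite /c2; move: (_ / _) (ln _) => a b; nra.
Qed.

(* [Nf] stands for the C*-norm on the unitization, up to constants; the last
   clause is what remains of the differential inequality there. *)
Definition flat_norm (k : nat) (r : R) (star : U -> U) (Nf : U -> R) : Prop :=
  [/\ forall x y, Nf (x + y) <= Nf x + Nf y,
      forall c x, Nf (c *: x) = modc c * Nf x,
      Nf 1 <= 1,
      forall z, Nf z ^+ 2 <= 16 * Nf (star z * z) &
      forall T, exists2 C : R, 1 <= C &
        forall z, Nf z <= T -> Num.max 1 (nU (z ^+ k)) <= C * Num.max 1 (nU z) `^ r].

(** The k-th power of z^(k^i) is z^(k^(i+1)), and the common bound [T] gives one constant for all
    i. *)
Lemma flat_bounded_subexp (k : nat) (r : R) star Nf (z : U) (T : R) :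
  1 < r -> flat_norm k r star Nf -> (forall n, Nf (z ^+ n) <= T) ->
  subexp k r (fun n => nU (z ^+ n)).
Proof.
move=> r1 [_ _ _ _ hN] zT; have [C C1 hC] := hN T.
apply: (power_recursion_subexp r1 C1) => i.
by rewrite expnSr exprM; exact: hC.
Qed.
End Growth.

(** * Completeness of the complex numbers *)

Section ComplexComplete.
Variable R : realType.

Lemma cauchy_real_cvg (u : nat -> R) :
  (forall e : R, 0 < e -> exists N : nat, forall m n : nat,
     (N <= m)%N -> (N <= n)%N -> `|u m - u n| < e) ->
  exists l : R, u @ \oo --> l.
Proof.
move=> hu; suff /cauchy_cvgP h : cauchy (u @ \oo) by exists (limn u).
apply: cauchy_exP => e e0; have [N hN] := hu e e0.
by exists (u N), N => // n Nn; exact: hN.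
Qed.

Lemma modc_complete (u : nat -> R[i]) :
  (forall e : R, 0 < e -> exists N : nat, forall m n : nat,
     (N <= m)%N -> (N <= n)%N -> modc (u m - u n) < e) ->
  exists l : R[i], forall e : R, 0 < e -> exists N : nat, forall n : nat,
     (N <= n)%N -> modc (u n - l) < e.
Proof.
move=> hu.
have [a ha] : exists l : R, (fun n => complex.Re (u n)) @ \oo --> l.
  apply: cauchy_real_cvg => e /hu[N hN]; exists N => m n Nm Nn.
  by apply: le_lt_trans (hN _ _ Nm Nn); rewrite -raddfB; exact: modc_Re.
have [b hb] : exists l : R, (fun n => complex.Im (u n)) @ \oo --> l.
  apply: cauchy_real_cvg => e /hu[N hN]; exists N => m n Nm Nn.
  by apply: le_lt_trans (hN _ _ Nm Nn); rewrite -raddfB; exact: modc_Im.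
exists (Complex a b) => e e0; have e20 : 0 < e / 2 by rewrite divr_gt0.
move/cvgrPdist_lt: ha => /(_ _ e20)[N _ hN].
move/cvgrPdist_lt: hb => /(_ _ e20)[M _ hM].
exists (maxn N M) => n; rewrite geq_max => /andP[/hN h1 /hM h2].
apply: le_lt_trans (modc_le _) _; move: h1 h2; rewrite /= distrC => h1; rewrite distrC => h2.
by case: (u n) h1 h2 => x y /=; lra.
Qed.
End ComplexComplete.

(** * Rules for the involution *)

Section Involution.
Variables (R : realType) (U : algType R[i]) (starU : U -> U).
Hypothesis hstar : involution *%R starU.
Implicit Types (u v : U) (c : R[i]).

Lemma starUP c u v : starU (c *: u + v) = conjc c *: starU u + starU v.
Proof. by case: hstar => h _ _; exact: h. Qed.
Lemma starUM u v : starU (u * v) = starU v * starU u.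
Proof. by case: hstar => _ h _; exact: h. Qed.
Lemma starUK u : starU (starU u) = u.
Proof. by case: hstar => _ _ h; exact: h. Qed.
Lemma starUD u v : starU (u + v) = starU u + starU v.
Proof. by have := starUP 1 u v; rewrite conjc1 !scale1r. Qed.
Lemma starU0 : starU 0 = 0.
Proof. by apply: (addIr (starU 0)); rewrite -starUD !add0r. Qed.
Lemma starUZ c u : starU (c *: u) = conjc c *: starU u.
Proof. by have := starUP c u 0; rewrite starU0 !addr0. Qed.
Lemma starUB u v : starU (u - v) = starU u - starU v.
Proof. by rewrite -scaleN1r addrC starUP rmorphN rmorph1 scaleN1r addrC. Qed.
Lemma starU1 : starU 1 = 1.
Proof. by have := starUM 1 (starU 1); rewrite mul1r starUK mul1r => <-. Qed.
Lemma starUX u n : starU (u ^+ n) = starU u ^+ n.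
Proof. by elim: n => [|n IH]; rewrite ?expr0 ?starU1// exprS starUM IH exprSr. Qed.

End Involution.

(** * The minimal unitization as a Banach algebra with a flat norm *)

Section Structure.
Variables (R : realType) (k : nat) (p q : R).
Variables (A : lmodType R[i]) (mulA : A -> A -> A) (starA : A -> A) (nrmA : A -> R).
Variables (B : lmodType R[i]) (mulB : B -> B -> B) (starB : B -> B) (nrmB : B -> R).
Variable iota : A -> B.
Variables (U : algType R[i]) (starU : U -> U) (nrmU : U -> R) (j : A -> U).
Hypothesis hdiff : differential_subalgebra k p q mulA starA nrmA mulB starB nrmB iota.
Hypothesis hunit : min_unitization mulA starA nrmA starU nrmU j.
Implicit Types (a b : A) (c l : R[i]) (u v z : U).

Lemma jP c a b : j (c *: a + b) = c *: j a + j b.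
Proof. by case: hunit => _ [_ [h _ _]] _ _ _; exact: h. Qed.
Lemma jM a b : j (mulA a b) = j a * j b.
Proof. by case: hunit => _ [_ [_ h _]] _ _ _; exact: h. Qed.
Lemma jstar a : j (starA a) = starU (j a).
Proof. by case: hunit => _ [_ [_ _ h]] _ _ _; exact: h. Qed.
Lemma j_inj : injective j.
Proof. by case: hunit => _ []. Qed.
Lemma jD a b : j (a + b) = j a + j b.
Proof. by have := jP 1 a b; rewrite !scale1r. Qed.
Lemma j0 : j 0 = 0.
Proof. by apply: (addIr (j 0)); rewrite -jD !add0r. Qed.
Lemma jZ c a : j (c *: a) = c *: j a.
Proof. by have := jP c a 0; rewrite j0 !addr0. Qed.
Lemma jB a b : j (a - b) = j a - j b.
Proof. by rewrite -scaleN1r addrC jP scaleN1r addrC. Qed.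
Lemma j_npow a n : j (npow mulA a n.+1) = j a ^+ n.+1.
Proof.
elim: n => [|n IH]; first by rewrite expr1.
by rewrite exprSr -IH -jM.
Qed.

Let hstar : involution *%R starU.
Proof. by case: hunit. Qed.

Lemma iotaP c a b : iota (c *: a + b) = c *: iota a + iota b.
Proof. by case: hdiff => _ _ [_ [h _ _]] _ _; exact: h. Qed.
Lemma iotaM a b : iota (mulA a b) = mulB (iota a) (iota b).
Proof. by case: hdiff => _ _ [_ [_ h _]] _ _; exact: h. Qed.
Lemma iotastar a : iota (starA a) = starB (iota a).
Proof. by case: hdiff => _ _ [_ [_ _ h]] _ _; exact: h. Qed.
Lemma iotaD a b : iota (a + b) = iota a + iota b.
Proof. by have := iotaP 1 a b; rewrite !scale1r. Qed.
Lemma iota0 : iota 0 = 0.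
Proof. by apply: (addIr (iota 0)); rewrite -iotaD !add0r. Qed.
Lemma iotaZ c a : iota (c *: a) = c *: iota a.
Proof. by have := iotaP c a 0; rewrite iota0 !addr0. Qed.

Lemma nrmA_ge0 a : 0 <= nrmA a.
Proof. by case: hdiff => _ [[[h _ _ _] _] _ _ _ _] _ _ _; exact: h. Qed.
Lemma nrmA_eq0 a : nrmA a = 0 -> a = 0.
Proof. by case: hdiff => _ [[[_ h _ _] _] _ _ _ _] _ _ _; exact: h. Qed.
Lemma nrmAD a b : nrmA (a + b) <= nrmA a + nrmA b.
Proof. by case: hdiff => _ [[[_ _ h _] _] _ _ _ _] _ _ _; exact: h. Qed.
Lemma nrmAZ c a : nrmA (c *: a) = modc c * nrmA a.
Proof. by case: hdiff => _ [[[_ _ _ h] _] _ _ _ _] _ _ _; exact: h. Qed.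
Lemma nrmAM a b : nrmA (mulA a b) <= nrmA a * nrmA b.
Proof. by case: hdiff => _ [_ _ h _ _] _ _ _; exact: h. Qed.
Lemma nrmA0 : nrmA 0 = 0.
Proof. by rewrite -(scale0r (0 : A)) nrmAZ modc0 mul0r. Qed.

Lemma nrmB_ge0 (b : B) : 0 <= nrmB b.
Proof. by case: hdiff => -[[[[h _ _ _] _] _ _ _ _] _] _ _ _ _; exact: h. Qed.
Lemma nrmBD (a b : B) : nrmB (a + b) <= nrmB a + nrmB b.
Proof. by case: hdiff => -[[[[_ _ h _] _] _ _ _ _] _] _ _ _ _; exact: h. Qed.
Lemma nrmBZ c (b : B) : nrmB (c *: b) = modc c * nrmB b.
Proof. by case: hdiff => -[[[[_ _ _ h] _] _ _ _ _] _] _ _ _ _; exact: h. Qed.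
Lemma nrmBM (a b : B) : nrmB (mulB a b) <= nrmB a * nrmB b.
Proof. by case: hdiff => -[[_ _ h _ _] _] _ _ _ _; exact: h. Qed.
Lemma nrmB_cstar (b : B) : nrmB (mulB (starB b) b) = nrmB b ^+ 2.
Proof. by case: hdiff => -[_ h] _ _ _ _; exact: h. Qed.
Lemma starBK (b : B) : starB (starB b) = b.
Proof. by case: hdiff => -[[_ _ _ [_ _ h] _] _] _ _ _ _; exact: h. Qed.
Lemma nrmB0 : nrmB 0 = 0.
Proof. by rewrite -(scale0r (0 : B)) nrmBZ modc0 mul0r. Qed.

Lemma nrmB_star_le (b : B) : nrmB b <= nrmB (starB b).
Proof.
have := nrmBM (starB b) b; rewrite nrmB_cstar expr2.
have [->|b0] := eqVneq (nrmB b) 0; first by rewrite nrmB_ge0.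
by rewrite ler_pM2r// lt0r b0 nrmB_ge0.
Qed.

Lemma nrmB_star (b : B) : nrmB (starB b) = nrmB b.
Proof. by apply/le_anti; rewrite nrmB_star_le -{2}[b]starBK nrmB_star_le. Qed.

Lemma kp_bounds : [/\ (2 <= k)%N, 0 < p, 0 < q & p + q = k%:R].
Proof. by case: hdiff. Qed.

(* In the non-unital case, (a + l)^k has cross terms of degree k - 1 in a; the
   exponent k - 1/2 dominates them and exceeds 1 even for k = 2. *)
Definition growth_exponent : R := Num.max p (k%:R - 2^-1).

Lemma growth_exponent_bounds : 1 < growth_exponent < k%:R.
Proof.
have [k2 p0 q0 pq] := kp_bounds; have : 2 <= k%:R :> R by rewrite ler_nat.
by rewrite /growth_exponent lt_max gt_max; lra.
Qed.

Lemma differential_bound : exists2 K : R, 0 < K & forall a,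
  nrmA (npow mulA a k) <= K * nrmA a `^ p * nrmB (iota a) `^ q.
Proof. by case: hdiff. Qed.

(** While the C*-norm stays below [T], the factor with exponent q is bounded by a constant and only
    the power p of [nrmA a] is left. *)
Lemma nrmA_npow_le (T : R) : exists2 C : R, 0 <= C & forall a, nrmB (iota a) <= T ->
  nrmA (npow mulA a k) <= C * Num.max 1 (nrmA a) `^ growth_exponent.
Proof.
have [k2 p0 q0 pq] := kp_bounds; have [K K0 hK] := differential_bound.
exists (K * Num.max 1 T `^ q) => [|a aT]; first by rewrite mulr_ge0 ?powR_ge0 ?(ltW K0).
apply: le_trans (hK a) _; rewrite mulrAC; apply: ler_pM; rewrite ?mulr_ge0 ?powR_ge0 ?(ltW K0)//.
  rewrite ler_wpM2l ?(ltW K0)// ge0_ler_powR ?nnegrE ?nrmB_ge0 ?(ltW q0)//.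
    by rewrite le_max ler01.
  by rewrite le_max aT orbT.
apply: (@le_trans _ _ (Num.max 1 (nrmA a) `^ p)).
  by rewrite ge0_ler_powR ?nnegrE ?nrmA_ge0 ?(ltW p0)// le_max ?ler01 ?lexx ?orbT.
by rewrite ler_powR ?le_max ?lexx// /growth_exponent le_max lexx.
Qed.

Lemma completeA (u : nat -> A) :
  (forall e : R, 0 < e -> exists N : nat, forall m n : nat,
     (N <= m)%N -> (N <= n)%N -> nrmA (u m - u n) < e) ->
  exists l : A, forall e : R, 0 < e -> exists N : nat, forall n : nat,
     (N <= n)%N -> nrmA (u n - l) < e.
Proof. by case: hdiff => _ [[_ h] _ _ _ _] _ _ _; exact: h. Qed.

(** Here [j] is an isometric bijection, and the flat norm is the C*-norm carried over to [U]. *)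
Lemma unital_flat_norm : has_unit mulA -> unital_banach_algebra nrmU /\
  exists Nf, flat_norm nrmU k growth_exponent starU Nf.
Proof.
move=> hu; have [k2 p0 q0 pq] := kp_bounds.
have [surj iso] : (forall u, exists a, u = j a) /\ (forall a, nrmU (j a) = nrmA a).
  by case: hunit => _ _ _ h _; exact: h.
have [g hg] := choice surj.
split.
  split; last first.
  - by move=> u v; rewrite (hg u) (hg v) -jM !iso nrmAM.
  - move=> u hu'; have [|l hl] := completeA (u := fun n => g (u n)).
      move=> e /hu'[N hN]; exists N => m n Nm Nn.
      by rewrite -iso jB -!hg; exact: hN.
    exists (j l) => e /hl[N hN]; exists N => n Nn.
    by rewrite (hg (u n)) -jB iso; exact: hN.
  - split.
    + by move=> u; rewrite (hg u) iso nrmA_ge0.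
    + by move=> u; rewrite (hg u) iso => /nrmA_eq0 ->; rewrite j0.
    + by move=> u v; rewrite (hg u) (hg v) -jD !iso nrmAD.
    + by move=> c u; rewrite (hg u) -jZ !iso nrmAZ.
have gj a : g (j a) = a by apply: j_inj; rewrite -hg.
exists (fun u => nrmB (iota (g u))); split.
- by move=> u v; rewrite (hg u) (hg v) -jD !gj iotaD nrmBD.
- by move=> c u; rewrite (hg u) -jZ !gj iotaZ nrmBZ.
(* The unit is a self-adjoint idempotent, so by the C*-identity its norm is 0 or 1. *)
- have [e he] := hu.
  have je : j e = 1 by have [a ha] := surj 1; rewrite -[LHS]mulr1 {1}ha -jM (he a).1.
  have se : starA e = e by apply: j_inj; rewrite jstar je (starU1 hstar).
  rewrite -je gj; have := nrmB_cstar (iota e).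
  rewrite -iotastar -iotaM se (he e).1; have := nrmB_ge0 (iota e).
  move: (nrmB _) => t; nra.
- move=> z; rewrite (hg z) -jstar -jM !gj iotaM iotastar nrmB_cstar.
  by rewrite ler_peMl ?sqr_ge0//; lra.
- move=> T; have [C C0 hC] := nrmA_npow_le T; exists (Num.max 1 C); first by rewrite le_max lexx.
  move=> z; rewrite (hg z) gj iso => /hC h.
  have X1 : 1 <= Num.max 1 (nrmA (g z)) `^ growth_exponent.
    rewrite -[leLHS](powRr0 (Num.max 1 (nrmA (g z)))) ler_powR ?le_max ?lexx//.
    by have := growth_exponent_bounds; lra.
  rewrite ge_max; apply/andP; split; first by rewrite -[leLHS]mulr1 ler_pM ?le_max ?lexx.
  case: k k2 h => // n _; rewrite -j_npow iso => /le_trans; apply.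
  by rewrite ler_wpM2r ?powR_ge0// le_max lexx orbT.
Qed.

(** The flat norm of a + l is the l^1 sum of the C*-norm of a and |l|. It satisfies the C*-identity
    only up to a constant, for which the 16 in [flat_norm] leaves room. *)
Lemma nonunital_flat_norm : ~ has_unit mulA -> unital_banach_algebra nrmU /\
  exists Nf, flat_norm nrmU k growth_exponent starU Nf.
Proof.
move=> hu; have [k2 p0 q0 pq] := kp_bounds.
have nE a l : nrmU (j a + l%:A) = nrmA a + modc l by case: hunit => _ _ _ _; exact.
have surj u : exists x : A * R[i], u = j x.1 + x.2%:A.
  by case: hunit => _ _ h _ _; have [a [l ->]] := h u; exists (a, l).
have [g hg] := choice surj.
have opD a b c l : j a + c%:A + (j b + l%:A) = j (a + b) + (c + l)%:A.
  by rewrite jD scalerDl addrACA.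
have opB a b c l : j a + c%:A - (j b + l%:A) = j (a - b) + (c - l)%:A.
  by rewrite jB scalerBl opprD addrACA.
have opZ a c l : l *: (j a + c%:A) = j (l *: a) + (l * c)%:A.
  by rewrite jZ scalerDr scalerA.
have opM a b c l : (j a + c%:A) * (j b + l%:A) =
    j (mulA a b + l *: a + c *: b) + (c * l)%:A.
  rewrite !jD jM !jZ mulrDl !mulrDr -!scalerAl -!scalerAr !mulr1 !mul1r scalerA addrA.
  by rewrite (addrAC (_ + _) (c *: _)).
have opstar a c : starU (j a + c%:A) = j (starA a) + (conjc c)%:A.
  by rewrite (starUD hstar) (starUZ hstar) (starU1 hstar) jstar.
have nrmU_eq0 u : nrmU u = 0 -> u = 0.
  rewrite (hg u) nE; have := nrmA_ge0 (g u).1; have := modc_ge0 (g u).2 => h1 h2 h3.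
  have /nrmA_eq0 -> : nrmA (g u).1 = 0 by lra.
  have /modc_eq0 -> : modc (g u).2 = 0 by lra.
  by rewrite j0 scale0r addr0.
(* [g] only chooses a decomposition; it is unique because the norm of 0 is the sum of the norms of
   the two differences. *)
have gj a l : g (j a + l%:A) = (a, l).
  have := nE (a - (g (j a + l%:A)).1) (l - (g (j a + l%:A)).2).
  rewrite -opB -hg subrr => h.
  have h0 : nrmU 0 = 0 by have := nE 0 0; rewrite j0 scale0r addr0 nrmA0 modc0 addr0.
  have h1 := nrmA_ge0 (a - (g (j a + l%:A)).1); have h2 := modc_ge0 (l - (g (j a + l%:A)).2).
  have /nrmA_eq0/subr0_eq ea : nrmA (a - (g (j a + l%:A)).1) = 0 by lra.
  have /modc_eq0/subr0_eq el : modc (l - (g (j a + l%:A)).2) = 0 by lra.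
  by rewrite [LHS]surjective_pairing -ea -el.
have hU : unital_banach_algebra nrmU.
  split; last first.
  - move=> u v; rewrite (hg u) (hg v) opM !nE modcM.
    move: (g u) (g v) => [a c] [b l] /=.
    have := nrmAD (mulA a b + l *: a) (c *: b); have := nrmAD (mulA a b) (l *: a).
    have := nrmAM a b; rewrite !nrmAZ; nra.
  - move=> u hu'.
    have [|a ha] := completeA (u := fun n => (g (u n)).1).
      move=> e /hu'[N hN]; exists N => m n Nm Nn.
      have := hN _ _ Nm Nn; rewrite {1}(hg (u m)) {1}(hg (u n)) opB nE; apply: le_lt_trans.
      by rewrite lerDl modc_ge0.
    have [|l hl] := modc_complete (u := fun n => (g (u n)).2).
      move=> e /hu'[N hN]; exists N => m n Nm Nn.
      have := hN _ _ Nm Nn; rewrite {1}(hg (u m)) {1}(hg (u n)) opB nE; apply: le_lt_trans.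
      by rewrite lerDr nrmA_ge0.
    exists (j a + l%:A) => e e0; have e20 : 0 < e / 2 by rewrite divr_gt0.
    have [N hN] := ha _ e20; have [M hM] := hl _ e20.
    exists (maxn N M) => n; rewrite geq_max => /andP[/hN h1 /hM h2].
    by rewrite (hg (u n)) opB nE; lra.
  - split => //.
    + by move=> u; rewrite (hg u) nE addr_ge0 ?nrmA_ge0 ?modc_ge0.
    + move=> u v; rewrite (hg u) (hg v) opD !nE.
      have := nrmAD (g u).1 (g v).1; have := modcD (g u).2 (g v).2; lra.
    + by move=> c u; rewrite (hg u) opZ !nE nrmAZ modcM mulrDr.
split=> //.
exists (fun u => nrmB (iota (g u).1) + modc (g u).2); split.
- move=> u v; rewrite {1 2}(hg u) {1 2}(hg v) opD gj /= iotaD.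
  have := nrmBD (iota (g u).1) (iota (g v).1); have := modcD (g u).2 (g v).2; lra.
- by move=> c u; rewrite {1 2}(hg u) opZ gj /= iotaZ nrmBZ modcM mulrDr.
- have g1 : g 1 = (0, 1) by rewrite -gj j0 scale1r add0r.
  have -> : (g 1).1 = 0 by rewrite g1.
  have -> : (g 1).2 = 1 by rewrite g1.
  by rewrite iota0 nrmB0 modc1 add0r.
- move=> z; rewrite {3 4 5 6}(hg z) opstar opM gj /=; move: (g z) => [a c] /=.
  rewrite !iotaD !iotaZ iotaM iotastar modcM modcJ.
  set b := iota a; set M := nrmB (_ + _).
  (* As 2 |c| |b| <= |b|^2 / 2 + 2 |c|^2, this gives |b|^2 <= 2 M + 4 |c|^2. *)
  have h : nrmB b ^+ 2 <= M + 2 * modc c * nrmB b.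
    rewrite -nrmB_cstar.
    have -> : mulB (starB b) b = (mulB (starB b) b + c *: starB b + conjc c *: b) +
        ((- c) *: starB b + (- conjc c) *: b) by rewrite !scaleNr; zmod.
    apply: le_trans (nrmBD _ _) _; rewrite lerD2l (le_trans (nrmBD _ _))//.
    by rewrite !nrmBZ !modcN modcJ nrmB_star; lra.
  have M0 : 0 <= M by exact: nrmB_ge0.
  have := sqr_ge0 (nrmB b - 2 * modc c); have := sqr_ge0 (nrmB b - modc c); nra.
- move=> T; have [C C0 hC] := nrmA_npow_le T.
  have T1 : 1 <= Num.max 1 T by rewrite le_max lexx.
  exists (Num.max 1 (C + Num.max 1 T * k%:R)); first by rewrite le_max lexx.
  move=> z; rewrite {3 4}(hg z); move: (g z) => [a c] /= hT; rewrite nE.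
  set X := Num.max 1 (nrmA a + modc c); have X1 : 1 <= X by rewrite le_max lexx.
  have aT : nrmB (iota a) <= T by apply: le_trans hT; rewrite lerDl modc_ge0.
  have cT : modc c <= Num.max 1 T.
    by rewrite le_max; apply/orP; right; apply: le_trans hT; rewrite lerDr nrmB_ge0.
  have Xr (s : R) : s <= growth_exponent -> X `^ s <= X `^ growth_exponent.
    by move=> ?; rewrite ler_powR.
  have gb := growth_exponent_bounds.
  have Xr1 : 1 <= X `^ growth_exponent.
    by rewrite -[leLHS](powRr0 X) Xr//; lra.
  have aX : nrmA a <= X by rewrite le_max; apply/orP; right; rewrite lerDl modc_ge0.
  have zX : nrmU (j a + c%:A) <= X by rewrite nE le_max lexx orbT.
  have ja0 : nrmU (j a) = nrmA a by have := nE a 0; rewrite scale0r addr0 modc0 addr0.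
  have n1 : nrmU 1 = 1 by have := nE 0 1; rewrite j0 scale1r add0r nrmA0 modc1 add0r.
  rewrite ge_max; apply/andP; split; first by rewrite -[leLHS]mulr1 ler_pM ?le_max ?lexx.
  apply: (@le_trans _ _ ((C + Num.max 1 T * k%:R) * X `^ growth_exponent)); last first.
    by rewrite ler_wpM2r ?powR_ge0// le_max lexx orbT.
  have comm_ja : GRing.comm (j a + c%:A) (j a).
    by rewrite /GRing.comm mulrDl mulrDr -scalerAl -scalerAr mul1r mulr1.
  (* The differential inequality controls a^k. The difference is c times a sum of k products of k -
     1 factors, each at most X^(k-1), and k - 1 is below the growth exponent. *)
  have -> : (j a + c%:A) ^+ k = j a ^+ k + ((j a + c%:A) ^+ k - j a ^+ k) by rewrite subrKC.
  apply: le_trans (nrmD hU _ _) _; rewrite [leRHS]mulrDl; apply: lerD.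
    have [n kE] : exists n, k = n.+1 by case: k k2 => // n _; exists n.
    have -> : nrmU (j a ^+ k) = nrmA (npow mulA a k).
      by rewrite kE -j_npow; have := nE (npow mulA a n.+1) 0; rewrite scale0r addr0 modc0 addr0.
    apply: le_trans (hC _ aT) _; apply: ler_wpM2l => //; apply: ge0_ler_powR.
    - by lra.
    - by rewrite nnegrE le_max ler01.
    - by rewrite nnegrE (le_trans ler01).
    - by rewrite ge_max X1 aX.
  rewrite (subrXX_comm k comm_ja) addrC addKr -scalerAl mul1r (nrmZ hU) -mulrA.
  apply: ler_pM => //; [exact: modc_ge0|exact: (nrm_ge0 hU)|].
  apply: le_trans (nrm_sum hU _ _ _) _.
  apply: (@le_trans _ _ (\sum_(i < k) X `^ growth_exponent)); last first.
    by rewrite sumr_const card_ord -[_ *+ k]mulr_natl.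
  apply: ler_sum => i _; apply: le_trans (nrmXM hU _ _ _) _.
  have hi : nrmU (j a ^+ i) <= X ^+ i.
    rewrite -[j a ^+ i]mulr1; apply: le_trans (nrmXM hU _ _ _) _; rewrite n1 mulr1.
    by rewrite lerXn2r ?nnegrE ?(nrm_ge0 hU) ?ja0// (le_trans ler01).
  apply: (@le_trans _ _ (X ^+ (k.-1 - i) * X ^+ i)).
    apply: ler_pM; rewrite ?exprn_ge0 ?(nrm_ge0 hU)//.
    by rewrite lerXn2r ?nnegrE ?(nrm_ge0 hU)// (le_trans ler01).
  rewrite -exprD subnK; last by rewrite -ltnS prednK ?ltn_ord// (ltn_trans _ k2).
  rewrite -powR_mulrn ?(le_trans ler01)//; apply: Xr.
  have : k%:R = k.-1%:R + 1 :> R by rewrite natr1 prednK// (ltn_trans _ k2).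
  by rewrite /growth_exponent le_max => ->; apply/orP; right; lra.
Qed.

Lemma unitization_flat_norm : unital_banach_algebra nrmU /\
  exists Nf, flat_norm nrmU k growth_exponent starU Nf.
Proof.
by have [hu|hu] := pselect (has_unit mulA); [exact: unital_flat_norm|exact: nonunital_flat_norm].
Qed.
End Structure.

(** * Commuting elements *)

Section Commutation.
Variables (R : realType) (X : algType R[i]).
Implicit Types (x y : X) (c : R[i]).

Lemma commrZ c x y : GRing.comm x y -> GRing.comm x (c *: y).
Proof. by rewrite /GRing.comm -scalerAl -scalerAr => ->. Qed.

Lemma commrA c x : GRing.comm x c%:A.
Proof. exact/commrZ/commr1. Qed.

Lemma commrDA c x y : GRing.comm x y -> GRing.comm x (y + c%:A).
Proof. by move=> xy; apply: commrD => //; exact: commrA. Qed.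
End Commutation.

(** * Unitaries, Cayley transforms and spectra of self-adjoint elements *)

Section Unitaries.
Variables (R : realType) (U : algType R[i]) (star : U -> U) (nU : U -> R).
Variables (k : nat) (r : R) (Nf : U -> R).
Hypotheses (hU : unital_banach_algebra nU) (hstar : involution *%R star).
Hypotheses (k1 : (1 < k)%N) (r1 : 1 < r < k%:R) (hNf : flat_norm nU k r star Nf).
Implicit Types (u v w h z : U) (c : R[i]).

Definition unitary u : Prop := star u * u = 1 /\ u * star u = 1.

Lemma unitaryM u v : unitary u -> unitary v -> unitary (u * v).
Proof.
move=> [su us] [sv vs]; split; rewrite (starUM hstar).
  by rewrite mulrA -(mulrA (star v)) su mulr1.
by rewrite mulrA -(mulrA u) vs mulr1.
Qed.

Lemma unitary_star u : unitary u -> unitary (star u).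
Proof. by move=> [su us]; split; rewrite (starUK hstar). Qed.

Lemma unitaryX u n : unitary u -> unitary (u ^+ n).
Proof.
move=> uu; elim: n => [|n IH]; last by rewrite exprS; exact: unitaryM.
by rewrite expr0; split; rewrite (starU1 hstar) mulr1.
Qed.

Lemma unitaryN u : unitary u -> unitary (- u).
Proof.
move=> [su us]; have sN : star (- u) = - star u.
  by rewrite -sub0r (starUB hstar) (starU0 hstar) sub0r.
by split; rewrite sN mulrNN.
Qed.

Lemma flat_norm_unitary u : unitary u -> Nf u <= 4.
Proof.
move=> [su _]; case: hNf => _ _ n1 /(_ u) + _; rewrite su => h.
by clear su; rewrite leNgt; apply/negP => h4; nra.
Qed.

Lemma unitary_subexp u : unitary u -> subexp k r (fun n => nU (u ^+ n)).
Proof.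
move=> uu; have /andP[r_gt1 _] := r1.
apply: (flat_bounded_subexp hU r_gt1 hNf (T := 4)) => n.
apply: flat_norm_unitary; exact: unitaryX.
Qed.

(** Subexponential growth means spectral radius at most 1: the powers of c z are O(s^n) with s
    halfway between |c| and 1, and the Neumann series converges. *)
Lemma subexp_resolvent z c : subexp k r (fun n => nU (z ^+ n)) -> modc c < 1 ->
  invertible (1 - c *: z).
Proof.
move=> sz c1; have [->|c0] := eqVneq c 0.
  by rewrite scale0r subr0; exact: invertible1.
have m0 := modc_gt0 c0; pose s := (1 + modc c) / 2.
have s01 : 0 < s < 1 by apply/andP; split; rewrite /s; lra.
have /andP[s0 s1] := s01.
have t01 : 0 < modc c / s < 1.
  by rewrite divr_gt0// ltr_pdivrMr// mul1r /s; lra.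
have [K hK] := subexp_geometric k1 r1 sz (fun n => nrm_ge0 hU _) t01.
apply: (neumann hU (K := K) (s := s)) => [|n]; first by rewrite (ltW s0) s1.
rewrite exprZn (nrmZ hU) modcX.
have := hK n; rewrite expr_div_n mulrAC ler_pdivrMr// exprn_gt0//.
Qed.

(** Both u and u^-1 = star u have spectral radius at most 1. Inside the circle u is factored out,
    outside it -c. *)
Lemma unitary_resolvent u c : unitary u -> modc c != 1 -> invertible (u - c%:A).
Proof.
move=> uu; have [su us] := uu; rewrite neq_lt => /orP[c1|c1].
  have -> : u - c%:A = u * (1 - c *: star u).
    by rewrite mulrBr mulr1 -scalerAr us.
  apply: invertibleM; first by exists (star u).
  by apply: subexp_resolvent => //; apply: unitary_subexp; exact: unitary_star.
have c0 : c != 0 by apply: contraTneq c1 => ->; rewrite modc0 ltr10.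
have -> : u - c%:A = (- c) *: (1 - c^-1 *: u).
  by rewrite scalerBr scalerA mulNr divff// scaleNr scaleN1r opprK addrC.
apply: invertibleZ; first by rewrite oppr_eq0.
apply: subexp_resolvent; first exact: unitary_subexp.
by rewrite modcV invf_lt1// (lt_trans ltr01).
Qed.

Lemma small_invertible z : nU z <= 2^-1 -> invertible (1 - z).
Proof.
move=> hz; apply: (neumann hU (K := nU 1) (s := 2^-1)) => [|n]; first by lra.
rewrite -[z ^+ n]mulr1 (le_trans (nrmXM hU _ _ _))// mulrC ler_wpM2l ?(nrm_ge0 hU)//.
by rewrite lerXn2r ?nnegrE ?(nrm_ge0 hU).
Qed.

(** As c is purely imaginary, [star] exchanges h + c and h - c, so [star g] inverts h - c. All these
    elements commute, whence the Cayley transform is unitary. *)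
Lemma cayley_unitary h g c : star h = h -> conjc c = - c ->
  (h + c%:A) * g = 1 -> g * (h + c%:A) = 1 ->
  [/\ star g * (h - c%:A) = 1, (h - c%:A) * star g = 1 & unitary ((h - c%:A) * g)].
Proof.
move=> sh sc hg gh.
have shp : star (h + c%:A) = h - c%:A.
  by rewrite (starUD hstar) (starUZ hstar) (starU1 hstar) sh sc scaleNr.
have shm : star (h - c%:A) = h + c%:A by rewrite -shp (starUK hstar).
have e1 : star g * (h - c%:A) = 1 by rewrite -shp -(starUM hstar) hg (starU1 hstar).
have e2 : (h - c%:A) * star g = 1 by rewrite -shp -(starUM hstar) gh (starU1 hstar).
have pm : GRing.comm (h + c%:A) (h - c%:A).
  rewrite -scaleNr; apply: commrDA; apply: commr_sym; apply: commrDA; exact: commr_refl.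
have gs : GRing.comm g (star g).
  apply: commr_sym; apply: (comm_inverse e2 e1).
  by apply: commr_sym; exact: (comm_inverse hg gh).
split=> //; split; rewrite (starUM hstar) shm.
  by rewrite mulrA -(mulrA (star g)) pm mulrA e1 mul1r hg.
by rewrite mulrA -(mulrA _ g) gs mulrA e2 mul1r gh.
Qed.

(** After scaling, h + i is inverted by a Neumann series; this gives a Cayley transform before the
    spectrum of h is known to be real. *)
Lemma scale_small h : exists2 t : R, 0 < t & nU ((t%:C)%C *: h) <= 2^-1.
Proof.
have n1 : 0 < nU h + 1 by rewrite ltr_wpDl// (nrm_ge0 hU).
exists (2 * (nU h + 1))^-1; first by rewrite invr_gt0 mulr_gt0.
rewrite (nrmZr hU) ger0_norm ?invr_ge0 ?mulr_ge0 ?(ltW n1)// invfM -mulrA ler_piMr//.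
by rewrite mulrC ler_pdivrMr// mul1r lerDl.
Qed.

Lemma star_realZ (t : R) h : star h = h -> star ((t%:C)%C *: h) = (t%:C)%C *: h.
Proof. by move=> sh; rewrite (starUZ hstar) conjc_real sh. Qed.

Lemma small_addi_invertible h : nU h <= 2^-1 -> invertible (h + 'i%C%:A).
Proof.
move=> hh; have -> : h + 'i%C%:A = 'i%C *: (1 - 'i%C *: h).
  by rewrite scalerBr scalerA -expr2 sqr_i scaleN1r opprK addrC.
apply: invertibleZ; first by rewrite eq_complex /= oner_eq0 andbF.
by apply: small_invertible; rewrite (nrmZ hU) modc_i mul1r.
Qed.

Lemma conjc_i : conjc 'i%C = - 'i%C :> R[i].
Proof. by apply/eqP; rewrite eq_complex /= oppr0 !eqxx. Qed.

(** For small h with Cayley transform u, h - l is a multiple of (u - m)(h + i), where m = (l - i) /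
    (l + i) is off the unit circle for nonreal l. The pole l = -i is treated apart, and scaling
    reduces the claim to small h. *)
Lemma selfadjoint_resolvent h c : star h = h -> complex.Im c != 0 ->
  invertible (h - c%:A).
Proof.
have small h' l : star h' = h' -> nU h' <= 2^-1 -> complex.Im l != 0 ->
    invertible (h' - l%:A).
  move=> sh hh l0.
  have [li|li] := eqVneq (l + 'i%C) 0.
    have -> : l = - 'i%C by apply/eqP; rewrite -addr_eq0 li.
    by rewrite scaleNr opprK; exact: small_addi_invertible.
  have [g [hg gh]] := small_addi_invertible hh.
  have [_ _ uu] := cayley_unitary sh conjc_i hg gh.
  pose m := (l - 'i%C) / (l + 'i%C).
  have m1 : modc m != 1.
    apply: contra_neq l0 => /eqP; rewrite /m modcM modcV.
    have lm : modc (l + 'i%C) != 0 by rewrite gt_eqF// modc_gt0.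
    rewrite -(inj_eq (mulIf lm)) divfK// mul1r => /eqP e.
    have : (modc (l - 'i%C) ^+ 2) = (modc (l + 'i%C)) ^+ 2 by rewrite e.
    case: (l) => a b; rewrite /modc /= !sqr_sqrtr ?addr_ge0 ?sqr_ge0//; lra.
  have m0 : 1 - m != 0.
    by rewrite subr_eq0; apply: contra_neq m1 => <-; rewrite modc1.
  have im : 'i%C * (1 + m) = l * (1 - m) by rewrite /m; field.
  have -> : h' - l%:A = (1 - m)^-1 *: (((h' - 'i%C%:A) * g - m%:A) * (h' + 'i%C%:A)).
    have -> : ((h' - 'i%C%:A) * g - m%:A) * (h' + 'i%C%:A) = (1 - m) *: (h' - l%:A).
      rewrite mulrBl -mulrA gh mulr1 -scalerAl mul1r scalerDr scalerA.
      rewrite [RHS]scalerBr scalerA [(1 - m) * l]mulrC -im mulrDr mulr1 !scalerDl scaleNr.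
      by rewrite scale1r [m * _]mulrC; zmod.
    by rewrite scalerA mulVf// scale1r.
  apply: invertibleZ; first by rewrite invr_eq0.
  apply: invertibleM; first exact: unitary_resolvent.
  exact: small_addi_invertible.
move=> sh c0; have [t t0 ht] := scale_small h.
have tC : (t%:C)%C != 0 :> R[i].
  by rewrite -(rmorph0 (real_complex R)) (inj_eq (@complexI R)) gt_eqF.
have -> : h - c%:A = (t%:C)%C^-1 *: ((t%:C)%C *: h - ((t%:C)%C * c)%:A).
  by rewrite scalerBr !scalerA mulrA mulVf// mul1r scale1r.
apply: invertibleZ; first by rewrite invr_eq0.
apply: small => //; first exact: star_realZ.
case: (c) c0 => a b /=; rewrite mul0r addr0 => b0.
by rewrite mulf_neq0// gt_eqF.
Qed.
End Unitaries.

(** * Invertibility modulo the kernel of [phi]: self-adjoint, general and normal elements *)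

Section Quotient.
Variables (R : realType) (U E : algType R[i]) (star : U -> U) (nU : U -> R) (nE : E -> R).
Variables (k : nat) (r : R) (Nf : U -> R) (phi : U -> E).
Hypotheses (hU : unital_banach_algebra nU) (hstar : involution *%R star).
Hypotheses (k1 : (1 < k)%N) (r1 : 1 < r < k%:R) (hNf : flat_norm nU k r star Nf).
Hypotheses (hE : unital_banach_algebra nE) (hphi : cont_unital_hom nU nE phi).
Implicit Types (a h x : U) (c : R[i]).

Lemma invertible_invertible_mod x : invertible x -> invertible_mod (ker_of phi) x.
Proof.
by move=> [y [xy yx]]; exists y; rewrite /ker_of /= xy yx subrr (phi0 hphi).
Qed.

Lemma invertible_mod_phi x : invertible_mod (ker_of phi) x -> invertible (phi x).
Proof.
move=> [y]; rewrite /ker_of /= !(phiB hphi) !(phiM hphi) (phi1 hphi).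
by move=> [/subr0_eq xy /subr0_eq yx]; exists (phi y).
Qed.

(** The sign of the unitary v is chosen so that 1 - v = 2 h' (h' + i)^-1 for a real multiple h' of
    h; then [subexp_invertible_mod] applies to v. *)
Lemma selfadjoint_invertible_mod h : star h = h -> invertible (phi h) ->
  invertible_mod (ker_of phi) h.
Proof.
move=> sh ih; have [t t0 ht] := scale_small hU h.
have tC : (t%:C)%C != 0 :> R[i].
  by rewrite -(rmorph0 (real_complex R)) (inj_eq (@complexI R)) gt_eqF.
set h' := (t%:C)%C *: h in ht.
have ih' : invertible (phi h') by rewrite (phiZ hphi); exact: invertibleZ.
have [g [hg gh]] := small_addi_invertible hU ht.
have [_ _ uu] := cayley_unitary hstar (star_realZ hstar t sh) (conjc_i R) hg gh.
pose v := - ((h' - 'i%C%:A) * g).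
have vu : unitary star v by exact: unitaryN.
have [sv vs] := vu.
have v1 : 1 - v = 2%:R *: (h' * g).
  rewrite /v opprK -{1}hg -mulrDl scalerAl; congr (_ * _).
  by rewrite scaler_nat mulr2n; zmod.
have two0 : 2%:R != 0 :> R[i] by rewrite pnatr_eq0.
have iv : invertible_mod (ker_of phi) (1 - v).
  apply: (subexp_invertible_mod hU hE hphi k1 r1 vs sv).
  - exact: (unitary_subexp hU hstar r1 hNf).
  - by apply: (unitary_subexp hU hstar r1 hNf); exact: unitary_star.
  - rewrite v1 (phiZ hphi) (phiM hphi); apply: invertibleZ => //; apply: invertibleM => //.
    by apply: (phi_invertible hphi); exists (h' + 'i%C%:A).
have -> : h = (1 - v) * ((2%:R * (t%:C)%C)^-1 *: (h' + 'i%C%:A)).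
  rewrite v1 -scalerAl -scalerAr -mulrA gh mulr1 !scalerA.
  by rewrite invfM mulrA divff// mul1r mulVf// scale1r.
apply: (invertible_modM hphi) => //; apply: invertible_invertible_mod.
apply: invertibleZ; first by rewrite invr_eq0 mulf_neq0.
by exists g.
Qed.

(** Since phi x = 0, 1 + star x may be replaced by 1 + star x - x = i (S - i) with S self-adjoint,
    and this is invertible already in [U]. *)
Lemma ker_star_invertible x : phi x = 0 -> invertible (phi (1 + star x)).
Proof.
move=> x0; pose S := - 'i%C *: (star x - x).
have sS : star S = S.
  rewrite /S (starUZ hstar) (starUB hstar) (starUK hstar).
  have -> : conjc (- 'i%C) = 'i%C :> R[i].
    by apply/eqP; rewrite eq_complex /= oppr0 opprK !eqxx.
  by rewrite scaleNr -scalerN opprB.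
have -> : phi (1 + star x) = phi ('i%C *: (S - 'i%C%:A)).
  rewrite /S scalerBr !scalerA mulrN -expr2 sqr_i opprK scale1r scaleN1r opprK.
  by rewrite (phiD hphi 1) (phiD hphi _ 1) (phiB hphi) x0 subr0 addrC.
apply: (phi_invertible hphi); apply: invertibleZ.
  by rewrite eq_complex /= oner_eq0 andbF.
by apply: (selfadjoint_resolvent hU hstar k1 r1 hNf) => //=; rewrite oner_eq0.
Qed.

(** If y inverts x modulo the kernel, then star y star x is 1 + star n with phi n = 0, and
    [ker_star_invertible] applies. Conversely, if y inverts the self-adjoint element star x x modulo
    the kernel, then y star x inverts x there. *)
Lemma invertible_modP x : invertible_mod (ker_of phi) x <->
  invertible (phi x) /\ invertible (phi (star x)).
Proof.
split=> [ix|[ix isx]].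
  split; first exact: invertible_mod_phi.
  have [y [xy yx]] := ix; rewrite /ker_of /= in xy yx.
  have e1 : star y * star x = 1 + star (x * y - 1).
    by rewrite (starUB hstar) (starU1 hstar) (starUM hstar) subrKC.
  have e2 : star x * star y = 1 + star (y * x - 1).
    by rewrite (starUB hstar) (starU1 hstar) (starUM hstar) subrKC.
  apply: (invertible_factors (y := phi (star y)) (z := phi (star y))).
    by rewrite -(phiM hphi) e2; exact: ker_star_invertible.
  by rewrite -(phiM hphi) e1; exact: ker_star_invertible.
have sl : invertible_mod (ker_of phi) (star x * x).
  apply: selfadjoint_invertible_mod; first by rewrite (starUM hstar) (starUK hstar).
  by rewrite (phiM hphi); exact: invertibleM.
have sr : invertible_mod (ker_of phi) (x * star x).
  apply: selfadjoint_invertible_mod; first by rewrite (starUM hstar) (starUK hstar).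
  by rewrite (phiM hphi); exact: invertibleM.
move: ix sl sr => [b [xb bx]] [y [_ +]] [y' [+ _]].
rewrite /ker_of /= !(phiB hphi) !(phiM hphi) (phi1 hphi).
move=> /subr0_eq yl /subr0_eq yr; exists (y * star x); rewrite /ker_of /=.
have bE : phi y * phi (star x) = b by rewrite -[LHS]mulr1 -xb !mulrA -(mulrA (phi y)) yl mul1r.
by rewrite !(phiB hphi) !(phiM hphi) (phi1 hphi) bE xb bx !subrr.
Qed.

(** The power expands into 2^n signed unitaries, each of flat norm at most 4; the factor v makes the
    induction go through. *)
Lemma flat_norm_sub_star_expr w : unitary star w ->
  forall n v, unitary star v -> Nf (v * (star w - w) ^+ n) <= 4 * 2 ^+ n.
Proof.
move=> uw; have [NfD NfZ _ _ _] := hNf.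
elim=> [|n IH] v uv; first by rewrite !expr0 !mulr1; exact: (flat_norm_unitary hNf).
have -> : v * (star w - w) ^+ n.+1 =
    (v * star w) * (star w - w) ^+ n + (- 1) *: ((v * w) * (star w - w) ^+ n).
  by rewrite exprS mulrA mulrBr mulrBl scaleN1r.
apply: le_trans (NfD _ _) _; rewrite NfZ modcN modc1 mul1r.
have h1 := IH _ (unitaryM hstar uv (unitary_star hstar uw)).
have h2 := IH _ (unitaryM hstar uv uw).
by rewrite exprS; lra.
Qed.

(* With c = it and F = c (a* a + c)^-1, the element z = a F satisfies
   z* z = (t / 4i) (w* - w) for a Cayley transform w, so its spectral radius is
   O(sqrt t). As phi F = (phi a)^-1 phi z, for small t the element
   1 - phi F = phi (a* a (a* a + c)^-1) is invertible. *)
Lemma normal_star_invertible a : a * star a = star a * a ->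
  invertible (phi a) -> invertible (phi (star a)).
Proof.
move=> na [b [ab ba]].
pose h := star a * a.
have sh : star h = h by rewrite (starUM hstar) (starUK hstar).
pose M := nE b + 1.
have M0 : 0 < M by rewrite ltr_wpDl// (nrm_ge0 hE).
(* The constants satisfy M (2 sg) = 1/2, the ratio of the final geometric series, and 2 (t / 4) =
   sg^2. *)
pose sg := (4 * M)^-1; have sg0 : 0 < sg by rewrite invr_gt0 mulr_gt0.
pose t := 2 * sg ^+ 2; have t0 : 0 < t by rewrite mulr_gt0// exprn_gt0.
pose c : R[i] := Complex 0 t.
have c0 : c != 0 by rewrite eq_complex /= (gt_eqF t0) andbF.
have cJ : conjc c = - c by apply/eqP; rewrite eq_complex /= oppr0 !eqxx.
have cm : modc c = t by rewrite /modc /= expr0n add0r sqrtr_sqr gtr0_norm.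
have [g [hg gh]] : invertible (h + c%:A).
  rewrite -[c]opprK scaleNr; apply: (selfadjoint_resolvent hU hstar k1 r1 hNf) => //=.
  by rewrite oppr_eq0 gt_eqF.
have [sgh hsg uw] := cayley_unitary hstar sh cJ hg gh.
set w := (h - c%:A) * g in uw.
have ah : GRing.comm a h by rewrite /GRing.comm /h mulrA na.
have sah : GRing.comm (star a) h by rewrite /GRing.comm /h -mulrA na.
have comm_g x : GRing.comm x h -> GRing.comm x g.
  move=> xh; apply: commr_sym; apply: (comm_inverse hg gh).
  by apply: commr_sym; exact: commrDA.
have comm_sg x : GRing.comm x h -> GRing.comm x (star g).
  move=> xh; apply: commr_sym; apply: (comm_inverse hsg sgh).
  by apply: commr_sym; rewrite -scaleNr; exact: commrDA.
have hh : GRing.comm h h by exact: commr_refl.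
have gsg : GRing.comm g (star g) by apply: comm_sg; apply: commr_sym; exact: comm_g.
pose F := c *: g; pose z := a * F.
have sz : star z = - c *: (star g * star a).
  by rewrite /z /F -scalerAr (starUZ hstar) (starUM hstar) cJ.
have zz : star z * z = (- c * c) *: (star g * h * g).
  by rewrite sz /z /F -(scalerAr c a g) -scalerAl -scalerAr scalerA /h !mulrA.
(* Between the outer factors [star g] and [g], this is (h + c)^2 - (h - c)^2 = 4 c h. *)
have wE : star w - w = (4%:R * c) *: (star g * h * g).
  have sw : star w = star g * (h + c%:A) * ((h + c%:A) * g).
    rewrite hg mulr1 /w (starUM hstar) (starUB hstar) (starUZ hstar) (starU1 hstar) sh cJ.
    by rewrite scaleNr opprK.
  have w2 : w = star g * (h - c%:A) * ((h - c%:A) * g) by rewrite sgh mul1r.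
  rewrite sw w2 -!mulrA -mulrBr (mulrA (h + _)) (mulrA (h - _)) -mulrBl.
  have -> : (h + c%:A) * (h + c%:A) - (h - c%:A) * (h - c%:A) = (4%:R * c) *: h.
    have -> : (4%:R * c) *: h = c *: h + c *: h + c *: h + c *: h.
      by rewrite -scalerA scaler_nat !mulrSr mulr0n add0r.
    rewrite !(mulrDl, mulrDr) !mulNr !mulrN -!scalerAl -!scalerAr !mul1r !mulr1; zmod.
  by rewrite -scalerAl -scalerAr /h -!mulrA.
have zw : star z * z = (- c / 4%:R) *: (star w - w).
  by rewrite zz wE scalerA [- c / 4%:R * _]mulrA divfK ?pnatr_eq0.
have zC : GRing.comm (star z) z.
  apply: commr_sym; rewrite sz; apply: commrZ; apply: commr_sym.
  rewrite /z /F -scalerAr; apply: commrZ.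
  apply: commrM.
    apply: commr_sym; apply: commrM; first exact: comm_sg.
    by rewrite /GRing.comm na.
  apply: commr_sym; apply: commrM => //.
  by apply: commr_sym; exact: comm_g.
have [_ NfZ _ Nfstar _] := hNf.
have u1 : unitary star 1 by have := unitaryX hstar 0 uw; rewrite expr0.
(* As z is normal, star (z^n) z^n is the n-th power of star z z; the constant comes from 16 times 4
   = 8^2. *)
have Nfz n : Nf (z ^+ n) ^+ 2 <= (8 * sg ^+ n) ^+ 2.
  apply: le_trans (Nfstar _) _.
  rewrite (starUX hstar) -exprMn_comm// zw exprZn NfZ modcX modcM modcN cm modcV.
  have -> : modc (4%:R : R[i]) = 4.
    by rewrite -(rmorph_nat (real_complex R)) modc_real normr_nat.
  have := flat_norm_sub_star_expr uw n u1; rewrite mul1r => hn.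
  have tq : 0 <= (t / 4) ^+ n by rewrite exprn_ge0// divr_ge0// ltW.
  have := ler_wpM2l tq hn.
  have -> : (t / 4) ^+ n * (4 * 2 ^+ n) = 4 * (sg ^+ n) ^+ 2.
    rewrite mulrCA -exprMn -exprM mulnC exprM; congr (_ * _ ^+ _).
    by rewrite /t; field.
  by rewrite exprMn; move: (_ * Nf _) => X hX; lra.
have sgC : (sg%:C)%C != 0 :> R[i].
  by rewrite -(rmorph0 (real_complex R)) (inj_eq (@complexI R)) gt_eqF.
(* The powers of z / sg are bounded in the flat norm, hence subexponential; comparing with the ratio
   1/2 gives |z^n| = O((2 sg)^n). *)
pose z' := (sg^-1)%:C%C *: z.
have Nfz' n : Nf (z' ^+ n) <= 8.
  have sgV : 0 <= sg^-1 by rewrite invr_ge0 ltW.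
  rewrite exprZn NfZ modcX modc_real (ger0_norm sgV) exprVn mulrC.
  rewrite ler_pdivrMr ?exprn_gt0//.
  have := Nfz n; rewrite leNgt; apply: contraTT; rewrite -!ltNge => lt8.
  by rewrite ltrXn2r// ?nnegrE// mulr_ge0// exprn_ge0// ltW.
have /andP[r_gt1 _] := r1.
have sz' := flat_bounded_subexp hU r_gt1 hNf Nfz'.
have half : 0 < (2^-1 : R) < 1 by lra.
have [K hK] := subexp_geometric k1 r1 sz' (fun n => nrm_ge0 hU _) half.
have znle n : nU (z ^+ n) <= K * (2 * sg) ^+ n.
  have -> : z = (sg%:C)%C *: z' by rewrite scalerA -rmorphM divff ?gt_eqF// rmorph1 scale1r.
  rewrite exprZn (nrmZ hU) modcX modc_real (gtr0_norm sg0) exprMn mulrA mulrC.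
  rewrite ler_wpM2r ?exprn_ge0 ?(ltW sg0)//.
  by have := hK n; rewrite exprVn mulrC ler_pdivrMr// exprn_gt0.
have [K0 K00 hK0] := phi_bounded hU hE hphi.
have bF : GRing.comm b (phi F).
  apply: (comm_inverse ab ba); rewrite /GRing.comm -!(phiM hphi); congr phi.
  by apply: commrZ; exact: comm_g.
have FE : phi F = b * phi z by rewrite (phiM hphi) mulrA ba mul1r.
have bz : GRing.comm b (phi z).
  by rewrite (phiM hphi); apply: commrM => //; rewrite /GRing.comm ab ba.
have iF : invertible (1 - phi F).
  apply: (neumann hE (K := K0 * K) (s := 2^-1)) => [|n]; first by lra.
  rewrite FE exprMn_comm// (le_trans (nrmXM hE _ _ _))// -(phiX hphi).
  apply: (@le_trans _ _ (M ^+ n * (K0 * (K * (2 * sg) ^+ n)))).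
    apply: ler_pM; rewrite ?exprn_ge0 ?(nrm_ge0 hE)//.
      by rewrite lerXn2r ?nnegrE ?(nrm_ge0 hE) ?(ltW M0)// /M lerDl.
    by apply: le_trans (hK0 _) _; rewrite ler_wpM2l ?(ltW K00).
  have -> : M ^+ n * (K0 * (K * (2 * sg) ^+ n)) = K0 * K * (M * (2 * sg)) ^+ n.
    by rewrite [in RHS]exprMn; move: (M ^+ n) ((2 * sg) ^+ n) => X Y; ring.
  have -> : M * (2 * sg) = 2^-1 by rewrite /sg; field; rewrite gt_eqF.
  by [].
(* From (h + c) g = 1 follows h g = 1 - c g = 1 - F. *)
have ihg : invertible (phi (h * g)).
  have -> : phi (h * g) = 1 - phi F; last by [].
  rewrite -(phi1 hphi) -(phiB hphi) -hg mulrDl /F -scalerAl mul1r; congr phi; zmod.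
have ih : invertible (phi h).
  have -> : phi h = phi (h * g) * phi (h + c%:A).
    by rewrite -(phiM hphi) -mulrA gh mulr1.
  by apply: invertibleM => //; apply: (phi_invertible hphi); exists g.
apply: (invertible_commM (y := phi a)); last by rewrite -(phiM hphi).
by rewrite /GRing.comm -!(phiM hphi) na.
Qed.
End Quotient.

(** * Spectra in the quotient and in the target algebra *)

Theorem theorem3p16 (R : realType) (k : nat) (p q : R)
  (A : lmodType R[i]) (mulA : A -> A -> A) (starA : A -> A) (nrmA : A -> R)
  (B : lmodType R[i]) (mulB : B -> B -> B) (starB : B -> B) (nrmB : B -> R)
  (iota : A -> B)
  (U : algType R[i]) (starU : U -> U) (nrmU : U -> R) (j : A -> U)
  (E : algType R[i]) (nrmE : E -> R) (phi : U -> E) :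
  differential_subalgebra k p q mulA starA nrmA mulB starB nrmB iota ->
  min_unitization mulA starA nrmA starU nrmU j ->
  unital_banach_algebra nrmE ->
  cont_unital_hom nrmU nrmE phi ->
  (forall a : U, a * starU a = starU a * a ->
     spec_quot (ker_of phi) a = spec (phi a)) /\
  (forall a : U,
     spec_quot (ker_of phi) a = spec (phi a) `|` conj_set (spec (phi (starU a)))).
Proof.
move=> hdiff hunit hE hphi.
have [hU [Nf hNf]] := unitization_flat_norm hdiff hunit.
have hstar : involution *%R starU by case: hunit.
have [k1 _ _ _] := kp_bounds hdiff; have r1 := growth_exponent_bounds hdiff.
have modP := invertible_modP hU hstar k1 r1 hNf hE hphi.
have phiA x (l : R[i]) : phi (x - l%:A) = phi x - l%:A.
  by rewrite (phiB hphi) (phiZ hphi) (phi1 hphi).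
have starA' x (l : R[i]) : starU (x - l%:A) = starU x - (conjc l)%:A.
  by rewrite (starUB hstar) (starUZ hstar) (starU1 hstar).
split=> a.
  move=> na; apply/seteqP; split=> l; rewrite /spec_quot /spec /= => hl; apply: contra_not hl.
    rewrite -phiA => il; apply/modP; split=> //.
    (* Subtracting a scalar keeps a normal, so the condition on the adjoint follows from the one on
       a - l. *)
    apply: (normal_star_invertible hU hstar k1 r1 hNf hE hphi) => //.
    by rewrite starA'; apply: commrB; [apply: commr_sym; apply: commrB|];
      rewrite ?/GRing.comm//; try exact: commrA; apply: commr_sym; exact: commrA.
  by move=> /modP[]; rewrite phiA.
apply/seteqP; split=> l; rewrite /spec_quot /spec /conj_set /=.
  move=> hl; apply: contrapT => /not_orP[h1 h2]; apply: hl; apply/modP; split.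
    by rewrite phiA; exact: contrapT.
  rewrite starA' phiA; apply: contrapT => h3; apply: h2.
  by exists (conjc l) => //; rewrite conjcK.
move=> hl /modP[i1 i2]; case: hl => [|[m hm ml]]; first by rewrite -phiA.
by apply: hm; rewrite -phiA -[m]conjcK ml -starA'.
Qed.
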